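(* Let $A\in\mathbb{R}^{n\times n}$ and let $l$ be an integer with $k_{\max}\le l\le n$. The two-stage algorithm (specified in the context) achieves an $\mathcal{O}(k_{\max}\log n)$-approximation for the $l$-MSCP. More specifically, let $M^{alg}_{ms}$ be the input configuration for the $l$-MSCP determined by the two-stage algorithm, and $M^{opt}_{ms}$ the optimal input configuration. Then one of the following two bounds is guaranteed: $$\|M^{alg}_{ms}\|_0\le k_{\max}(\log(N)+1)\|M^{opt}_{ms}\|_0-(k_{\max}-1)l,\qquad(\mathrm{I})$$ $$\|M^{alg}_{ms}\|_0\le(\log(N)+1)\|M^{opt}_{ms}\|_0,\qquad(\mathrm{II})$$ where $N=\sum_{i=1}^{p_r+p_c/2}k_i\le n$. In particular, if no vertex is colored by more than one color in the final $\mathcal{G}_{color}$ of the algorithm, bound (II) is guaranteed; otherwise bound (I) is guaranteed. Moreover, the two-stage algorithm achieves an $\mathcal{O}(\log n)$-approximation under each of the following circumstances: (i) every eigenvalue of $A$ has geometric multiplicity $1$, i.e. $k_1=\dots=k_p=1$; (ii) $\sum_{i\in\{1,\dots,p_r+p_c/2\}\setminus\{i^*\}}\binom{k_i}{2}<k_{\max}$, where $i^*$ is such that $\lambda_{i^*}$ is the unique eigenvalue with geometric multiplicity $k_{\max}$ among $\{\lambda_1,\dots,\lambda_{p_r+p_c/2}\}$; (iii) $l\ge\min\left\{\sum_{i=1}^{p_r+p_c/2}k_i,\ 1+\sum_{i=1}^{p_r+p_c/2}\binom{k_i}{2}\right\}$.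
   Context: $(A,B)$ controllable refers to the system $\dot x(t)=Ax(t)+Bu(t)$. $\log$ is the natural logarithm. $A$ has $p$ distinct eigenvalues $\lambda_1,\dots,\lambda_p$, of which $p_r$ are real and $p_c=p-p_r$ are non-real, ordered so that $\lambda_1,\dots,\lambda_{p_r}$ are real and $\{\lambda_{p_r+i},\lambda_{p_r+i+p_c/2}\}$, $i=1,\dots,p_c/2$, are the complex conjugate pairs. $k_i=n-\mathrm{rank}(\lambda_iI-A)$ is the geometric multiplicity and $k_{\max}=\max_{1\le i\le p}k_i$. $X_i\in\mathbb{C}^{n\times k_i}$ has linearly independent columns spanning the left null space of $\lambda_iI-A$ (so $X_i^{\intercal}(\lambda_iI-A)=0$). With $X_{i\mathcal{J}}^{\intercal}$ the columns of $X_i^{\intercal}$ indexed by $\mathcal{J}$, $H_i=\{\mathcal{J}\subseteq\{1,\dots,n\}:|\mathcal{J}|=k_i,\ X_{i\mathcal{J}}^{\intercal}\text{ has full row rank}\}$. The $l$-MSCP: find $B\in\mathbb{R}^{n\times l}$ with the minimum number of nonzero entries such that $(A,B)$ is controllable. An input configuration is a sparsity pattern $\bar B\in\{0,\ast\}^{n\times l}$; it is feasible if some real $B$ with $B_{ij}=0$ whenever $\bar B_{ij}=0$ makes $(A,B)$ controllable; $\|\bar B\|_0$ is its number of nonzero ($\ast$) entries; it is optimal if it is feasible with minimum $\|\cdot\|_0$. An algorithm achieves an $\alpha$-approximation if it returns a feasible configuration whose number of nonzero entries is at most $\alpha$ times the optimum. Two-stage algorithm. Input: $A$ and $l\ge k_{\max}$.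 Step 1: compute $X_1,\dots,X_p$. Step 2: compute $S\subseteq V=\{1,\dots,n\}$ by the greedy algorithm: with $f(S)=\sum_{i=1}^p\mathrm{rank}(X_{iS}^{\intercal})$, start from $S=\emptyset$ and, while $f(S)<\sum_{i=1}^pk_i$, add to $S$ an element $a\in V\setminus S$ maximizing $f(S\cup\{a\})-f(S)$. Then determine sets $h_i\in H_i$ with $h_i\subseteq S$ for $i=1,\dots,p_r+p_c/2$. Step 3: construct the auxiliary graph $\mathcal{G}(h_1,\dots,h_{p_r+p_c/2})$: the simple undirected graph with vertex set $\bigcup_ih_i$ in which distinct $j,k$ are adjacent iff $j,k\in h_i$ for some $i$. Step 4: initialize $\mathcal{G}_{color}=\mathcal{G}(h_1,\dots,h_{p_r+p_c/2})$ with no vertex colored; the colors are $1,\dots,l$. Repeat until no vertex of $\mathcal{G}_{color}$ is uncolored: among all uncolored vertices choose one, $v^\ast$, adjacent (in $\mathcal{G}_{color}$) to the largest number of differently colored vertices; if $v^\ast$ has $l$ differently colored neighbors, assign to $v^\ast$ $k^\ast_{\max}$ distinct colors, where $k^\ast_{\max}=\max\{k_i:v^\ast\in h_i,\ 1\le i\le p_r+p_c/2\}$, and remove the edges between $v^\ast$ and its neighbors from $\mathcal{G}_{color}$; otherwise assign to $v^\ast$ one color different from those of its colored neighbors, such that the number of already used colors is minimized (an already used color is reused when possible). Step 5: output $\bar B\in\{0,\ast\}^{n\times l}$ with $\bar B_{ij}=\ast$ iff vertex $i$ is colored by color $j$ in $\mathcal{G}_{color}$, all other entries being fixed zeros. 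*)

(* Defs.v *)
From HB Require Import structures.
From mathcomp Require Import all_boot all_order all_algebra.
From mathcomp Require Import complex.
From mathcomp Require Import all_classical all_reals all_analysis.

Set Implicit Arguments.
Unset Strict Implicit.
Unset Printing Implicit Defensive.

Import Order.TTheory GRing.Theory Num.Theory.
Import numFieldNormedType.Exports.
Local Open Scope ring_scope.

(* The number p_c of non-real eigenvalues of a real matrix is even; it is
   written q + q below, so that p = pr + q + q. *)

(* Complete controllability of x' = A x + B u with continuous inputs; the
   trajectory is required to be continuous on [0, T] and to satisfy the
   equation (entrywise) on ]0, T[. *)
Definition controllable (R : realType) (n l : nat)
    (A : 'M[R]_n) (B : 'M[R]_(n, l)) : Prop :=
  forall x0 x1 : 'cV[R]_n,
  exists (T : R) (u : R -> 'cV[R]_l) (x : R -> 'cV[R]_n),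
    [/\ 0 < T,
        forall j, ({within `[0, T], continuous (fun t => u t j 0)})%classic,
        forall i, ({within `[0, T], continuous (fun t => x t i 0)})%classic,
        x 0 = x0 /\ x T = x1
      & forall t i, 0 < t < T ->
          is_derive t 1 (fun s => x s i 0) ((A *m x t + B *m u t) i 0)].

Section Configurations.
Variables (R : realType) (n l : nat).
Implicit Types (A : 'M[R]_n) (Bbar : 'M[bool]_(n, l)).

(* An input configuration is a boolean matrix, true standing for a free
   entry and false for a fixed zero. *)
Definition nnz Bbar : nat := #|[set ij | Bbar ij.1 ij.2]|.

Definition feasible A Bbar : Prop :=
  exists2 B : 'M[R]_(n, l),
    forall i j, ~~ Bbar i j -> B i j = 0 & controllable A B.

Definition optimal A Bbar : Prop :=
  feasible A Bbar /\ forall Bbar', feasible A Bbar' -> (nnz Bbar <= nnz Bbar')%N.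

End Configurations.

Section Spectrum.
Variables (R : realType) (n : nat).
Implicit Types (A : 'M[R]_n).

Definition cplx_mx A : 'M[R[i]]_n := map_mx (real_complex R) A.

Definition geo_mult A (z : R[i]) : nat := (n - \rank (z%:M - cplx_mx A)%R)%N.

(* The indices [lshift q (lshift q i)], [lshift q (rshift pr j)] and
   [rshift (pr + q) j] are those of the real eigenvalues, of the chosen
   representatives of the conjugate pairs, and of their conjugates. *)
Definition spectrum_ordering A (pr q : nat) (lam : 'I_(pr + q + q) -> R[i]) : Prop :=
  [/\ injective lam,
      forall z, eigenvalue (cplx_mx A) z <-> exists i, lam i = z,
      forall i : 'I_pr, lam (lshift q (lshift q i)) \is Num.real
    & forall j : 'I_q, lam (lshift q (rshift pr j)) \isn't Num.real /\
        lam (rshift (pr + q) j) = Num.conj (lam (lshift q (rshift pr j)))].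

End Spectrum.

Section TwoStage.
Variables (R : realType) (n : nat) (A : 'M[R]_n).
Variables (pr q : nat) (lam : 'I_(pr + q + q) -> R[i]).

Definition mult (i : 'I_(pr + q + q)) : nat := geo_mult A (lam i).

Definition kmax : nat := \max_(i < pr + q + q) mult i.

(* Multiplicities of the real eigenvalues and of one representative of each
   conjugate pair. *)
Definition rmult (i : 'I_(pr + q)) : nat := mult (lshift q i).

Definition Nmult : nat := \sum_(i < pr + q) rmult i.

Definition left_null_basis (i : 'I_(pr + q + q)) (X : 'M[R[i]]_(n, mult i)) : Prop :=
  row_free X^T /\ (X^T == kermx ((lam i)%:M - cplx_mx A))%MS.

Definition cols_in (k : nat) (J : {set 'I_n}) (M : 'M[R[i]]_(k, n)) : 'M[R[i]]_(k, #|J|) :=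
  colsub (fun j : 'I_#|J| => enum_val j) M.

Section Greedy.
Variable X : forall i, 'M[R[i]]_(n, mult i).

Definition Hset i : {set {set 'I_n}} :=
  [set J : {set 'I_n} | (#|J| == mult i) && row_free (cols_in J (X i)^T)].

Definition rank_sum (S : {set 'I_n}) : nat :=
  \sum_(i < pr + q + q) \rank (cols_in S (X i)^T).

(* rank_sum is monotone, so the truncated differences are the exact gains. *)
Inductive greedy_reach : {set 'I_n} -> Prop :=
| Greedy_init : greedy_reach finset.set0
| Greedy_step S a :
    greedy_reach S -> (rank_sum S < \sum_(i < pr + q + q) mult i)%N ->
    a \notin S ->
    (forall b, b \notin S ->
       (rank_sum (b |: S) - rank_sum S <= rank_sum (a |: S) - rank_sum S)%N) ->
    greedy_reach (a |: S).

Definition greedy_output (S : {set 'I_n}) : Prop :=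
  greedy_reach S /\ ~~ (rank_sum S < \sum_(i < pr + q + q) mult i)%N.

End Greedy.

Section Coloring.
Variables (l : nat) (h : 'I_(pr + q) -> {set 'I_n}).

(* The set of colors assigned to each vertex, set0 meaning uncolored. *)
Let coloring := {ffun 'I_n -> {set 'I_l}}.

Definition aux_vertices : {set 'I_n} := \bigcup_i h i.

Definition aux_graph : rel 'I_n :=
  fun j k => (j != k) && [exists i, (j \in h i) && (k \in h i)].

Definition kstar (v : 'I_n) : nat := \max_(i | v \in h i) rmult i.

Definition uncolored (c : coloring) v : bool :=
  (v \in aux_vertices) && (c v == finset.set0).

Definition nbr_colors (g : rel 'I_n) (c : coloring) v : {set 'I_l} :=
  \bigcup_(w | g v w) c w.

Definition used_colors (c : coloring) : {set 'I_l} := \bigcup_w c w.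

Definition assign (c : coloring) v (C : {set 'I_l}) : coloring :=
  [ffun w => if w == v then C else c w].

Definition isolate (g : rel 'I_n) v : rel 'I_n :=
  fun j k => [&& g j k, j != v & k != v].

(* A vertex is never adjacent in g to a vertex carrying several colors, since
   the edges of such a vertex are removed as soon as it is colored; hence
   #|nbr_colors g c v| counts the differently colored neighbors of v. *)
Definition selectable (g : rel 'I_n) (c : coloring) v : Prop :=
  uncolored c v /\
  forall w, uncolored c w -> (#|nbr_colors g c w| <= #|nbr_colors g c v|)%N.

Inductive coloring_reach : rel 'I_n -> coloring -> Prop :=
| Coloring_init : coloring_reach aux_graph [ffun=> finset.set0]
| Coloring_multi g c v (C : {set 'I_l}) :
    coloring_reach g c -> selectable g c v ->
    #|nbr_colors g c v| = l -> #|C| = kstar v ->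
    coloring_reach (isolate g v) (assign c v C)
| Coloring_single g c v x :
    coloring_reach g c -> selectable g c v ->
    #|nbr_colors g c v| <> l -> x \notin nbr_colors g c v ->
    (forall y, y \notin nbr_colors g c v ->
       (#|x |: used_colors c| <= #|y |: used_colors c|)%N) ->
    coloring_reach g (assign c v [set x]).

Definition coloring_output (c : coloring) : Prop :=
  (exists g, coloring_reach g c) /\ forall v, ~~ uncolored c v.

End Coloring.

(* c is the final coloring of some execution of the two-stage algorithm, for
   some resolution of its free choices (bases X_i, ties, sets h_i, colors). *)
Definition two_stage (l : nat) (c : {ffun 'I_n -> {set 'I_l}}) : Prop :=
  exists (X : forall i, 'M[R[i]]_(n, mult i)) (S : {set 'I_n})
         (h : 'I_(pr + q) -> {set 'I_n}),
    [/\ forall i, left_null_basis (X i),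
        greedy_output X S,
        forall i, h i \in Hset X (lshift q i) /\ h i \subset S
      & coloring_output h c].

Definition output_config (l : nat) (c : {ffun 'I_n -> {set 'I_l}}) : 'M[bool]_(n, l) :=
  \matrix_(i, j) (j \in c i).

Definition multicolored (l : nat) (c : {ffun 'I_n -> {set 'I_l}}) : Prop :=
  exists v, (1 < #|c v|)%N.

(* On this instance the algorithm returns an output, and every output it may
   return is feasible and within the factor alpha of the optimum. *)
Definition achieves_approx (l : nat) (alpha : R) : Prop :=
  (exists c : {ffun 'I_n -> {set 'I_l}}, two_stage c) /\
  forall c : {ffun 'I_n -> {set 'I_l}}, two_stage c ->
    feasible A (output_config c) /\
    forall Bopt : 'M[bool]_(n, l), optimal A Bopt ->
      (nnz (output_config c))%:R <= alpha * (nnz Bopt)%:R.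

End TwoStage.

Definition O_log (R : realType) (alpha : nat -> R) : Prop :=
  alpha =O_ eventually (fun n : nat => ln (n%:R : R)).

Definition instance (R : realType) (n : nat) (A : 'M[R]_n) (pr q : nat)
    (lam : 'I_(pr + q + q) -> R[i]) (l : nat) : Prop :=
  spectrum_ordering A lam /\ (kmax A lam <= l <= n)%N.

(* Main.v *)
Require Import Defs.
From mathcomp Require Import all_boot all_order all_algebra.
From mathcomp Require Import complex.
From mathcomp Require Import all_classical all_reals all_analysis.
From mathcomp Require Import zify ring lra.

Set Implicit Arguments.
Unset Strict Implicit.
Unset Printing Implicit Defensive.

Import Order.TTheory GRing.Theory Num.Theory.
Import numFieldNormedType.Exports.
Local Open Scope ring_scope.

(** The proof compares three quantities: the number of free entries produced by
    the coloring, the number of vertices kept by the greedy selection, and the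
    number of nonzero rows of an optimal configuration.

    Controllability is first turned into linear algebra by the Hautus test: (A, B)
    is controllable exactly when no left eigenvector of A is killed by B
    ([controllable_hautus], [hautus_controllable]).  If v A = a v and v B = 0, then
    y = v x solves y' = a y along every trajectory, so that a trajectory from 0
    keeps y = 0.  Conversely the left kernel of (B, A B, A^2 B, ...) is stable under
    A, so it is zero when it contains no eigenvector, and this provides matrices
    C_k with sum_k A^k B C_k = 1.  Such an identity steers the system by
    polynomials: given a curve z joining the two end points and w = z' - A z, the
    curve z corrected by a differential expression in w is a trajectory, with input
    sum_k C_k w^(k); choosing z so that w vanishes to high order at both ends keeps
    the end points ([kalman_trajectory], [kalman_controllable]).

    Lower bound.  The Hautus test says that X_i^T B has full row rank for all i, so
    the set of nonzero rows of a feasible configuration has the maximal rank sum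
    ([feasible_rank_sum]).  The rank sum is monotone and submodular, whence the
    classical logarithmic guarantee for the greedy set S: with k <= F the size of any
    set of maximal rank sum F, |S| <= k (1 + ln (F / k)).  Conjugate eigenvalues are
    counted twice in F, so F <= 2 N only, but the factor 2 disappears: for k >= 2
    it is absorbed by the division by k, and for k = 1 one greedy step suffices
    ([greedy_size]).

    Feasibility of the output.  Inside a clique h_i, vertices whose edges were kept
    have pairwise distinct colors and the others have at least k_i colors each, so
    that h_i has distinct representatives among its colors
    ([coloring_output_matching]).  These representatives give a 0/1 matrix B_i with
    X_i^T B_i of full row rank, and a matrix which works for all i at once is found
    on lines between two candidates, outside the roots of finitely many nonzero
    polynomials ([generic_feasible]).

    Upper bound.  A vertex gets several colors only after l other vertices got
    exactly one color each, which saves (kmax - 1) l entries in bound (I)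
    ([nnz_le_multi]); otherwise every vertex of the graph contributes a single entry
    ([nnz_le_single]).  In cases (ii) and (iii) no selected vertex sees l colors.  In case
    (iii) this is a bound on degrees.  In case (ii) it comes from the rule which
    always colors a vertex of maximal saturation: whenever the saturation of an
    uncolored vertex of the large clique exceeds the number of colored vertices of
    that clique, it has been paid for by edges of the other cliques, and these are
    too few ([saturation_inv], [dominant_clique_single]). *)

(** * Steering by polynomial curves *)

Section PolynomialCurves.
Variables (R : realType) (n l : nat) (A : 'M[R]_n) (B : 'M[R]_(n, l)).

Notation deriv_mx := (map_mx (@deriv R)).
Notation poly_mx := (map_mx (@polyC R)).

Definition eval_mx (a : R) m k (z : 'M[{poly R}]_(m, k)) : 'M[R]_(m, k) :=
  map_mx (fun p : {poly R} => p.[a]) z.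

Lemma deriv_mxD m k (z w : 'M[{poly R}]_(m, k)) :
  deriv_mx (z + w) = deriv_mx z + deriv_mx w.
Proof. by apply/matrixP => i j; rewrite !mxE derivD. Qed.

Lemma deriv_mx0 m k : deriv_mx (0 : 'M[{poly R}]_(m, k)) = 0.
Proof. by apply/matrixP => i j; rewrite !mxE deriv0. Qed.

Lemma deriv_mx_sum m k (I : finType) (F : I -> 'M[{poly R}]_(m, k)) :
  deriv_mx (\sum_i F i) = \sum_i deriv_mx (F i).
Proof. by apply: (big_morph _ (@deriv_mxD m k) (deriv_mx0 m k)). Qed.

Lemma deriv_mulmx m k s (M : 'M[R]_(m, k)) (z : 'M[{poly R}]_(k, s)) :
  deriv_mx (poly_mx M *m z) = poly_mx M *m deriv_mx z.
Proof.
apply/matrixP => i j; rewrite !mxE (raddf_sum (@deriv R)); apply: eq_bigr => x _.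
by rewrite !mxE /= derivM derivC mul0r add0r.
Qed.

Lemma eval_mulmx a m k s (M : 'M[R]_(m, k)) (z : 'M[{poly R}]_(k, s)) :
  eval_mx a (poly_mx M *m z) = M *m eval_mx a z.
Proof.
apply/matrixP => i j; rewrite !mxE horner_sum; apply: eq_bigr => x _.
by rewrite !mxE hornerM hornerC.
Qed.

Lemma eval_mxD a m k (z w : 'M[{poly R}]_(m, k)) :
  eval_mx a (z + w) = eval_mx a z + eval_mx a w.
Proof. by apply/matrixP => i j; rewrite !mxE hornerD. Qed.

Lemma eval_mx0 a m k : eval_mx a (0 : 'M[{poly R}]_(m, k)) = 0.
Proof. by apply/matrixP => i j; rewrite !mxE horner0. Qed.

(** The failure of a curve to be a trajectory of the uncontrolled system. *)
Definition defect (z : 'cV[{poly R}]_n) : 'cV[{poly R}]_n :=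
  deriv_mx z - poly_mx A *m z.

Lemma defectD z w : defect (z + w) = defect z + defect w.
Proof. by rewrite /defect deriv_mxD mulmxDr opprD addrACA. Qed.

Lemma defect_sum (I : finType) (F : I -> 'cV[{poly R}]_n) :
  defect (\sum_i F i) = \sum_i defect (F i).
Proof.
apply: (big_morph _ defectD); by rewrite /defect deriv_mx0 mulmx0 subrr.
Qed.

(** With D = d/dt this is the sum over j < k of A^(k-1-j) D^j v, the quotient of
    D^k - A^k by D - A applied to v. *)
Fixpoint correction k (v : 'cV[{poly R}]_n) : 'cV[{poly R}]_n :=
  if k is k'.+1 then poly_mx A *m correction k' v + iter k' deriv_mx v else 0.

Lemma defect_correction k v :
  defect (correction k v) = iter k deriv_mx v - poly_mx (A ^+ k) *m v.
Proof.
elim: k => [|k IH] /=.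
  by rewrite expr0 map_mx1 mul1mx subrr /defect deriv_mx0 mulmx0 subrr.
rewrite defectD {1}/defect deriv_mulmx -mulmxBr -/(defect _) IH.
rewrite /defect exprS -mulmxE map_mxM mulmxBr mulmxA.
by rewrite addrC addrA subrK.
Qed.

Lemma eval_correction a k v :
  (forall j, (j < k)%N -> eval_mx a (iter j deriv_mx v) = 0) ->
  eval_mx a (correction k v) = 0.
Proof.
elim: k => [|k IH] h /=; first exact: eval_mx0.
rewrite eval_mxD eval_mulmx IH ?mulmx0 ?h ?addr0 // => j jk; exact/h/ltnW.
Qed.

Lemma iter_deriv_mulmx j m k s (M : 'M[R]_(m, k)) (z : 'M[{poly R}]_(k, s)) :
  iter j deriv_mx (poly_mx M *m z) = poly_mx M *m iter j deriv_mx z.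
Proof. by elim: j => //= j ->; rewrite deriv_mulmx. Qed.

(** The corrections cancel the part sum_k A^k B C_k w = w of the defect w of z and
    leave B times an input.  They only involve derivatives of w of order less than N,
    so they vanish wherever these derivatives do. *)
Lemma kalman_trajectory N (C : 'I_N -> 'M[R]_(l, n)) z :
  \sum_(k < N) A ^+ k *m B *m C k = 1%:M ->
  exists x u, [/\ deriv_mx x = poly_mx A *m x + poly_mx B *m u &
    forall a, (forall j, (j < N)%N -> eval_mx a (iter j deriv_mx (defect z)) = 0) ->
      eval_mx a x = eval_mx a z].
Proof.
move=> hC; set w := defect z.
pose x := z + \sum_(k < N) correction k (poly_mx (B *m C k) *m w).
pose u := \sum_(k < N) poly_mx (C k) *m iter k deriv_mx w.
exists x, u; split; last first.
  move=> a ha; rewrite /x eval_mxD.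
  rewrite (big_morph (@eval_mx a _ _) (@eval_mxD a _ _) (@eval_mx0 a _ _)) big1 ?addr0//.
  move=> k _; apply: eval_correction => j jk.
  by rewrite iter_deriv_mulmx eval_mulmx ha ?mulmx0 // (ltn_trans jk).
suff hx : defect x = poly_mx B *m u by rewrite -hx /defect addrC subrK.
rewrite /x defectD defect_sum -/w.
under eq_bigr => k _.
  rewrite defect_correction iter_deriv_mulmx mulmxA -map_mxM mulmxA; over.
rewrite sumrB -mulmx_suml -(raddf_sum (map_mx (@polyC R))) /= hC map_mx1 mul1mx.
rewrite addrC subrK /u mulmx_sumr; apply: eq_bigr => k _.
by rewrite map_mxM mulmxA.
Qed.

Lemma dvdp_deriv_exp (d p : {poly R}) m : d ^+ m.+1 %| p -> d ^+ m %| p^`().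
Proof.
case/dvdpP => q ->; rewrite derivM.
have dd : d ^+ m %| d ^+ m.+1 by rewrite exprS dvdp_mull.
by rewrite dvdp_add ?dvdp_mull // deriv_exp /= -mulrnAl dvdp_mull.
Qed.

Lemma eval_iter_deriv_dvd (a : R) m j (w : 'cV[{poly R}]_n) :
  (forall i, ('X - a%:P) ^+ m %| w i 0) -> (j < m)%N ->
  eval_mx a (iter j deriv_mx w) = 0.
Proof.
elim: j m w => [|j IH] m w hw jm.
  apply/matrixP => i k; rewrite (ord1 k) !mxE; apply/eqP.
  rewrite -/(root _ _) -dvdp_XsubCl; apply: dvdp_trans (hw i).
  by case: m jm {hw} => // m _; rewrite exprS dvdp_mulr.
case: m hw jm => // m hw jm; rewrite iterSr; apply: IH jm => i.
by rewrite mxE dvdp_deriv_exp.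
Qed.

(** The truncation at order m of t |-> exp ((t - a) A) x0: its defect is a single
    monomial of degree m, hence vanishes to order m at a. *)
Fixpoint taylor (a : R) m (x0 : 'cV[R]_n) : 'cV[{poly R}]_n :=
  if m is m'.+1 then
    taylor a m' x0 + ((m`!%:R^-1)%:P * ('X - a%:P) ^+ m) *: poly_mx (A ^+ m *m x0)
  else poly_mx x0.

Lemma eval_taylor a m x0 : eval_mx a (taylor a m x0) = x0.
Proof.
elim: m => [|m IH] /=.
  by apply/matrixP => i j; rewrite !mxE hornerC.
rewrite eval_mxD IH -[RHS]addr0; congr (_ + _).
by apply/matrixP => i j; rewrite !mxE !hornerE subrr expr0n mulr0 mul0r.
Qed.

Lemma deriv_mxZ m k (p : {poly R}) (M : 'M[R]_(m, k)) :
  deriv_mx (p *: poly_mx M) = p^`() *: poly_mx M.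
Proof. by apply/matrixP => i j; rewrite !mxE derivM derivC mulr0 addr0. Qed.

Lemma defect_taylor a m x0 :
  defect (taylor a m x0) =
  - (((m`!%:R^-1)%:P * ('X - a%:P) ^+ m) *: poly_mx (A ^+ m.+1 *m x0)).
Proof.
elim: m => [|m IH].
  rewrite /= /defect expr0 expr1 fact0 invr1 mulr1 scale1r map_mxM -[RHS]add0r.
  by congr (_ - _); apply/matrixP => i j; rewrite !mxE derivC.
rewrite [taylor _ _ _]/= defectD IH /defect deriv_mxZ -scalemxAr -map_mxM.
rewrite mulmxA mulmxE -exprS addrA -[RHS]add0r; congr (_ - _).
rewrite addrC; apply/eqP; rewrite subr_eq0; apply/eqP; congr (_ *: _).
rewrite derivM derivC mul0r add0r deriv_exp derivXsubC mul1r /=.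
rewrite mulrnAr -mulrnAl; congr (_ * _); rewrite -[LHS](polyCMn m.+1); congr (_%:P).
by rewrite factS natrM -(mulr_natr (_^-1)) invfM mulrAC mulVf ?mul1r // pnatr_eq0.
Qed.

(** Adding to e a curve multiplied by a polynomial flat at a point does not spoil the
    order of vanishing of the defect at that point; this glues two Taylor curves. *)
Lemma defect_blend (d p : {poly R}) m (e z : 'cV[{poly R}]_n) :
  (forall i, d ^+ m %| defect e i 0) -> d ^+ m.+1 %| p ->
  forall i, d ^+ m %| defect (e + p *: z) i 0.
Proof.
move=> he hp i; rewrite defectD mxE dvdp_add // /defect -scalemxAr !mxE.
rewrite derivM; have hp' : d ^+ m %| p by apply: dvdp_trans hp; rewrite exprS dvdp_mull.
by rewrite dvdp_sub ?dvdp_add // dvdp_mulr // dvdp_deriv_exp.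
Qed.

(** A polynomial flat at 0 and at 1, with values 0 and 1: take 1 - (1 - X^m)^m. *)
Lemma blend_poly m : exists2 p : {poly R},
  ('X - 0%:P) ^+ m %| p & ('X - 1%:P) ^+ m %| 1 - p.
Proof.
exists (1 - (1 - 'X ^+ m) ^+ m); last first.
  rewrite subKr dvdp_exp2r //.
  by rewrite dvdp_XsubCl /root !hornerE expr1n subrr.
rewrite subr0 -{1}(expr1n _ m) subrXX dvdp_mulr //.
by rewrite subKr.
Qed.

(** Two Taylor curves, one for each end point, are glued by a polynomial flat to order
    N + 1: differentiation costs one order, and N orders are left for the defect. *)
Lemma kalman_controllable N (C : 'I_N -> 'M[R]_(l, n)) :
  \sum_(k < N) A ^+ k *m B *m C k = 1%:M -> controllable A B.
Proof.
move=> hC x0 x1.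
have [p hp0 hp1] := blend_poly N.+1.
pose e0 := taylor 0 N x0; pose e1 := taylor 1 N x1.
pose z := e0 + p *: (e1 - e0).
have zE : z = e1 + (1 - p) *: (e0 - e1).
  by rewrite scalerBl scale1r addrA addrCA subrr addr0 -scalerN opprB.
have taylor_dvd a y i : ('X - a%:P) ^+ N %| defect (taylor a N y) i 0.
  by rewrite defect_taylor !mxE dvdpNr dvdp_mulr ?dvdp_mull.
have [x [u [hx hev]]] := kalman_trajectory z hC.
have x0E : eval_mx 0 x = x0.
  rewrite hev => [|j jN]; last first.
    apply: (eval_iter_deriv_dvd _ jN); apply: defect_blend => // i.
    exact: taylor_dvd.
  rewrite eval_mxD eval_taylor -[RHS]addr0; congr (_ + _).
  apply/matrixP => i j; rewrite !mxE hornerM.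
  have /eqP -> : root p 0 by rewrite -dvdp_XsubCl (dvdp_trans _ hp0) // exprS dvdp_mulr.
  by rewrite mul0r.
have x1E : eval_mx 1 x = x1.
  rewrite hev => [|j jN]; last first.
    apply: (eval_iter_deriv_dvd _ jN); rewrite zE.
    by apply: defect_blend => // i; exact: taylor_dvd.
  rewrite zE eval_mxD eval_taylor -[RHS]addr0; congr (_ + _).
  apply/matrixP => i j; rewrite !mxE hornerM.
  have /eqP -> : root (1 - p) 1.
    by rewrite -dvdp_XsubCl (dvdp_trans _ hp1) // exprS dvdp_mulr.
  by rewrite mul0r.
exists 1, (fun t => eval_mx t u), (fun t => eval_mx t x); split => //.
- move=> j; have -> : (fun t => eval_mx t u j 0) = horner (u j 0).
    by apply/funext => t; rewrite !mxE.
  exact/continuous_subspaceT/continuous_horner.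
- move=> i; have -> : (fun t => eval_mx t x i 0) = horner (x i 0).
    by apply/funext => t; rewrite !mxE.
  exact/continuous_subspaceT/continuous_horner.
- move=> t i _; have -> : (fun t => eval_mx t x i 0) = horner (x i 0).
    by apply/funext => s; rewrite !mxE.
  apply: trigger_derive.
  rewrite -!eval_mulmx -eval_mxD -hx !mxE //.
Qed.

End PolynomialCurves.

(** * The Hautus test *)

(** By Cayley-Hamilton every power of A is a combination of the first n ones. *)
Lemma krylov_kernel_stable (F : fieldType) n l m (A : 'M[F]_n) (B : 'M[F]_(n, l))
    (w : 'M[F]_(m, n)) :
  (forall k, (k < n)%N -> w *m (A ^+ k *m B) = 0) ->
  forall k, w *m (A ^+ k *m B) = 0.
Proof.
case: n A B w => [|n] A B w hw k; first by rewrite thinmx0 mul0mx.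
have -> : A ^+ k = horner_mx A ('X^k %% char_poly A).
  have := congr1 (horner_mx A) (divp_eq 'X^k (char_poly A)).
  rewrite rmorphXn /= horner_mx_X => ->.
  by rewrite rmorphD rmorphM /= Cayley_Hamilton mulr0 add0r.
set p := _ %% _; rewrite -[p]coefK poly_def rmorph_sum /= mulmx_suml mulmx_sumr.
have szp : (size p <= n.+1)%N.
  by rewrite -ltnS -(size_char_poly A) ltn_modpN0 // -size_poly_eq0 size_char_poly.
apply: big1 => i _; rewrite linearZ /= rmorphXn /= horner_mx_X.
by rewrite -scalemxAl -scalemxAr hw ?scaler0 // (leq_trans (ltn_ord i)).
Qed.

Lemma stable_eigenvector (F : closedFieldType) n m (A : 'M[F]_n) (W : 'M[F]_(m, n)) :
  stablemx W A -> W != 0 ->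
  exists a, exists2 v : 'rV[F]_n, v != 0 & (v <= W)%MS /\ v *m A = a *: v.
Proof.
move=> WA W0; have rW : (0 < \rank W)%N by rewrite lt0n mxrank_eq0.
have /closed_rootP [a ra] : size (char_poly (restrictmx W A)) != 1%N.
  by rewrite size_char_poly; case: (\rank W) rW.
rewrite -eigenvalue_root_char in ra; have /eigenvalueP [u ua u0] := ra.
exists a, (u *m row_base W).
  by rewrite mulmx_free_eq0 ?row_base_free.
split; first by rewrite (submx_trans (submxMl _ _)) // eq_row_base.
have sb : stablemx (row_base W) A by rewrite stablemx_row_base.
move/eigenspaceP: ua; rewrite sub_eigenspace_conjmx ?row_base_free //.
by move/eigenspaceP.
Qed.

Lemma map_mxX (S T : pzRingType) (f : {rmorphism S -> T}) n (A : 'M[S]_n) k :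
  map_mx f (A ^+ k) = map_mx f A ^+ k.
Proof.
elim: k => [|k IH]; first by rewrite !expr0 map_mx1.
by rewrite !exprS -!mulmxE map_mxM IH.
Qed.

Section HautusTest.
Variables (R : realType) (n l : nat) (A : 'M[R]_n) (B : 'M[R]_(n, l)).

Notation cmx := (map_mx (real_complex R)).

(** Stated on left eigenvectors rather than on the rank of (a - A, B), because the
    left null bases X_i of the algorithm enter exactly in this form. *)
Definition hautus : Prop := forall (a : R[i]) (v : 'rV[R[i]]_n),
  v *m cplx_mx A = a *: v -> v *m cmx B = 0 -> v = 0.

(** The left kernel K of the Krylov matrix (B, A B, ..., A^(n-1) B) is stable under A;
    if it were nonzero it would contain an eigenvector, which B kills.  A right
    inverse of the Krylov matrix, cut into blocks, provides the matrices C_k. *)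
Lemma hautus_controllable : hautus -> controllable A B.
Proof.
move=> hH.
pose M := \mxrow_(k < n) (A ^+ k *m B).
suff : row_free M.
  case/row_freeP => D MD; apply: (@kalman_controllable _ _ _ _ _ n (submxcol D)).
  by rewrite -(submxcolK D) mul_mxrow_mxcol in MD.
rewrite -(row_free_map (real_complex R)) -kermx_eq0.
apply: contraT => K0; set K := kermx _ in K0.
have KB k : K *m (cplx_mx A ^+ k *m cmx B) = 0.
  apply: krylov_kernel_stable => {}k kn.
  have sub_row j : submxrow (K *m cmx M) j = K *m cmx (submxrow M j).
    by apply/matrixP => i s; rewrite !mxE; apply: eq_bigr => r _; rewrite !mxE.
  have := sub_row (Ordinal kn); rewrite mulmx_ker submxrow0 mxrowK map_mxM /=.
  by rewrite map_mxX => <-.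
have KA : stablemx K (cplx_mx A).
  apply/sub_kermxP; apply/mxrowP => j; rewrite submxrow0.
  have sub_row : submxrow (K *m cplx_mx A *m cmx M) j =
                 K *m (cplx_mx A *m cmx (submxrow M j)).
    rewrite mulmxA.
    by apply/matrixP => i s; rewrite !mxE; apply: eq_bigr => r _; rewrite !mxE.
  rewrite sub_row mxrowK map_mxM map_mxX (mulmxA (map_mx _ A)) mulmxE.
  by rewrite -exprS KB.
have [a [v v0 [vK va]]] := stable_eigenvector KA K0.
case/negP: v0; apply/eqP/(hH a v va).
have := KB 0; rewrite expr0 mul1mx => KB0.
by case/submxP: vK => D ->; rewrite -mulmxA KB0 mulmx0.
Qed.

(** For a left eigenvector v killed by B, y = v x satisfies y' = a y on each
    trajectory; hence |y|^2 exp (- 2 Re a t) is constant, and y stays zero if x starts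
    at 0.  Steering to a basis vector shows that the coordinates of v vanish. *)
Lemma controllable_hautus : controllable A B -> hautus.
Proof.
move=> hc a v va vB; apply/eqP/contraT => /rV0Pn [k vk].
have [T [u [x [T0 _ hx [x0 xT] hd]]]] := hc 0 (delta_mx k 0).
(* the equation v A = a v is split into its real and imaginary parts *)
pose vr : 'rV[R]_n := \row_i complex.Re (v 0 i).
pose vi : 'rV[R]_n := \row_i complex.Im (v 0 i).
have vrA : vr *m A = complex.Re a *: vr - complex.Im a *: vi.
  apply/rowP => j; move/rowP/(_ j)/(congr1 (@complex.Re R)): va; rewrite !mxE.
  rewrite raddf_sum /= => e; apply: etrans (etrans e _); last by case: (a) (v 0 j) => [? ?] [].
  by apply: eq_bigr => i _; rewrite !mxE; case: (v 0 i) => /= ? ?; rewrite mulr0 subr0.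
have viA : vi *m A = complex.Im a *: vr + complex.Re a *: vi.
  apply/rowP => j; move/rowP/(_ j)/(congr1 (@complex.Im R)): va; rewrite !mxE.
  rewrite raddf_sum /= => e; apply: etrans (etrans e _); last first.
    by case: (a) (v 0 j) => [? ?] [? ?] /=; rewrite addrC.
  by apply: eq_bigr => i _; rewrite !mxE; case: (v 0 i) => /= ? ?; rewrite mulr0 add0r.
have vrB : vr *m B = 0.
  apply/rowP => j; move/rowP/(_ j)/(congr1 (@complex.Re R)): vB; rewrite !mxE.
  rewrite raddf_sum /= => e; apply: etrans e.
  by apply: eq_bigr => i _; rewrite !mxE; case: (v 0 i) => /= ? ?; rewrite mulr0 subr0.
have viB : vi *m B = 0.
  apply/rowP => j; move/rowP/(_ j)/(congr1 (@complex.Im R)): vB; rewrite !mxE.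
  rewrite raddf_sum /= => e; apply: etrans e.
  by apply: eq_bigr => i _; rewrite !mxE; case: (v 0 i) => /= ? ?; rewrite mulr0 add0r.
pose p t := (vr *m x t) 0 0; pose q t := (vi *m x t) 0 0.
have dlin (c : 'rV[R]_n) t : 0 < t < T ->
    is_derive t 1 (fun t => (c *m x t) 0 0) ((c *m (A *m x t + B *m u t)) 0 0).
  move=> t0T.
  have -> : (fun t => (c *m x t) 0 0) = \sum_(i < n) (fun t => c 0 i * x t i 0).
    by apply/funext => s; rewrite !mxE fct_sumE.
  rewrite [X in is_derive _ _ _ X]mxE; apply: is_derive_sum => i.
  exact: is_deriveZ (hd t i t0T).
have dp t : 0 < t < T -> is_derive t 1 p (complex.Re a * p t - complex.Im a * q t).
  move=> t0T; apply: trigger_derive (dlin vr t t0T) _.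
  by rewrite mulmxDr !mulmxA vrA vrB mul0mx addr0 mulmxBl -!scalemxAl /p /q !mxE.
have dq t : 0 < t < T -> is_derive t 1 q (complex.Im a * p t + complex.Re a * q t).
  move=> t0T; apply: trigger_derive (dlin vi t t0T) _.
  by rewrite mulmxDr !mulmxA viA viB mul0mx addr0 mulmxDl -!scalemxAl /p /q !mxE.
have lin_cont (c : 'rV[R]_n) :
    {within `[0, T], continuous (fun t => (c *m x t) 0 0)}%classic.
  have -> : (fun t => (c *m x t) 0 0) = \sum_(i < n) (fun t => c 0 i * x t i 0).
    by apply/funext => s; rewrite !mxE fct_sumE.
  elim/big_ind : _ => [|f1 f2 h1 h2 t|i _ t].
  - by move=> t; exact: cst_continuous.
  - by apply: continuousD; [exact: h1|exact: h2].
  - by apply: continuousM; [exact: cst_continuous|exact: hx].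
pose g t := (p t * p t + q t * q t) * expR (- (2 * complex.Re a) * t).
have dg t : t \in `]0, T[%R -> is_derive t 1 g 0.
  rewrite in_itv /= => t0T.
  have ip := dp t t0T; have iq := dq t t0T.
  apply: trigger_derive.
  rewrite /GRing.scale /=.
  ring.
have cg : {within `[0, T], continuous g}%classic.
  have cp : {within `[0, T], continuous p}%classic by exact: lin_cont.
  have cq : {within `[0, T], continuous q}%classic by exact: lin_cont.
  have cM (f1 f2 : R -> R) : {within `[0, T], continuous f1}%classic ->
      {within `[0, T], continuous f2}%classic ->
      {within `[0, T], continuous (fun t => f1 t * f2 t : R)}%classic.
    by move=> h1 h2 t; apply: continuousM; [exact: h1|exact: h2].
  have cD : {within `[0, T], continuous (fun t => p t * p t + q t * q t : R)}%classic.
    move=> t; apply: (continuousD (cM _ _ cp cp t) (cM _ _ cq cq t)).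
  apply: (cM _ _ cD); apply: continuous_subspaceT => s.
  apply: (@continuous_comp _ _ _ (fun t => - (2 * complex.Re a) * t) expR).
    by apply: continuousM; [exact: cst_continuous|exact: cvg_id].
  exact: continuous_expR.
have [c _] := MVT T0 dg cg; rewrite mul0r => /eqP; rewrite subr_eq0.
have xTE w : (w *m x T) 0 0 = w 0 k :> R.
  rewrite xT mxE (bigD1 k) //= mxE !eqxx mulr1 big1 ?addr0 // => i /negPf ik.
  by rewrite mxE ik mulr0.
rewrite /g /p /q !xTE x0 !mulmx0 !mxE mul0r addr0 mul0r -!expr2.
rewrite mulf_eq0 (gt_eqF (expR_gt0 _)) orbF paddr_eq0 ?sqr_ge0 // !sqrf_eq0.
by move=> /andP [/eqP r0 /eqP i0]; rewrite eq_complex r0 i0 /= eqxx in vk.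
Qed.
End HautusTest.

(** * Ranks of column selections *)

Section ColumnRank.
Variables (R : realType) (n k : nat) (M : 'M[R[i]]_(k, n)).
Implicit Types (S T : {set 'I_n}).

(** Ranks of column selections become dimensions of sums of lines, for which
    monotonicity and submodularity are dimension counts. *)
Lemma rank_cols_inE S :
  \rank (cols_in S M) = \rank (\sum_(a in S) <<row a M^T>>)%MS.
Proof.
rewrite -mxrank_tr trmx_mxsub; apply/eqmx_rank/andP; split.
  apply/row_subP => i; rewrite row_rowsub.
  by rewrite (sumsmx_sup (enum_val i)) ?enum_valP // genmxE.
apply/sumsmx_subP => a aS; rewrite genmxE.
by rewrite (eq_row_sub (enum_rank_in aS a)) // row_rowsub enum_rankK_in.
Qed.

Lemma rank_cols_in_mono S T :
  S \subset T -> (\rank (cols_in S M) <= \rank (cols_in T M))%N.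
Proof.
move=> ST; rewrite !rank_cols_inE mxrankS //; apply/sumsmx_subP => a aS.
by rewrite (sumsmx_sup a) // (fintype.subsetP ST).
Qed.

(** For U and V the spans attached to S and T and w the line of a, the intersection of
    V and U + w contains U. *)
Lemma rank_cols_in_submod S T a : S \subset T ->
  (\rank (cols_in (a |: T) M) + \rank (cols_in S M) <=
   \rank (cols_in T M) + \rank (cols_in (a |: S) M))%N.
Proof.
move=> ST; rewrite !rank_cols_inE -[leqRHS]mxrank_sum_cap leq_add // mxrankS //.
  apply/sumsmx_subP => b /setU1P [->|bT].
    by rewrite (submx_trans _ (addsmxSr _ _)) // (sumsmx_sup a) // setU11.
  by rewrite (submx_trans _ (addsmxSl _ _)) // (sumsmx_sup b).
rewrite sub_capmx; apply/andP; split; apply/sumsmx_subP => b bS.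
  by rewrite (sumsmx_sup b) // (fintype.subsetP ST).
by rewrite (sumsmx_sup b) // in_setU1 bS orbT.
Qed.

Lemma rank_cols_in_full : \rank (cols_in [set: 'I_n] M) = \rank M.
Proof.
rewrite rank_cols_inE -[RHS]mxrank_tr; apply/eqmx_rank/andP; split.
  by apply/sumsmx_subP => a _; rewrite genmxE row_sub.
by apply/row_subP => a; rewrite (sumsmx_sup a) ?genmxE // inE.
Qed.

Lemma rank_cols_in_basis S :
  exists2 J : {set 'I_n}, J \subset S &
    #|J| = \rank (cols_in S M) /\ \rank (cols_in J M) = \rank (cols_in S M).
Proof.
pose f := maxrankfun (cols_in S M)^T.
exists [set enum_val (f i) | i : 'I_(\rank (cols_in S M)^T)].
  by apply/fintype.subsetP => _ /imsetP [i _ ->]; apply: enum_valP.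
have cJ : #|[set enum_val (f i) | i : 'I_(\rank (cols_in S M)^T)]| =
    \rank (cols_in S M).
  rewrite card_imset ?card_ord ?mxrank_tr // => i j /enum_val_inj; exact: maxrankfun_inj.
split=> //; apply/eqP; rewrite eqn_leq; apply/andP; split.
  by rewrite -[leqRHS]cJ rank_leq_col.
rewrite [leqRHS]rank_cols_inE.
apply: (@leq_trans (\rank (rowsub f (cols_in S M)^T))).
  by rewrite eq_maxrowsub mxrank_tr.
apply: mxrankS.
apply/row_subP => i; rewrite row_rowsub.
have rowE j : row j (cols_in S M)^T = row (enum_val j) M^T.
  by apply/rowP => s; rewrite !mxE.
apply: (sumsmx_sup (enum_val (f i))); first by apply/imsetP; exists i.
by rewrite rowE genmxE.
Qed.
End ColumnRank.

(** * Submodular greedy selection *)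

Section SubmodularGain.
Variables (T : finType) (f : {set T} -> nat).
Hypothesis f_mono : forall S U : {set T}, S \subset U -> (f S <= f U)%N.
Hypothesis f_submod : forall (S U : {set T}) a, S \subset U ->
  (f (a |: U) + f S <= f U + f (a |: S))%N.

(** Adding the elements of U one at a time, each gain is at most the gain over S. *)
Lemma submod_gain_sum (S U : {set T}) :
  (f (S :|: U) <= f S + \sum_(a in U) (f (a |: S) - f S))%N.
Proof.
suff H s : (f (S :|: [set x in s]) <= f S + \sum_(a <- s) (f (a |: S) - f S))%N.
  by have := H (enum U); rewrite set_enum big_enum.
elim: s => [|a s IH].
  rewrite big_nil addn0 f_mono // finset.subUset subxx.
  by apply/fintype.subsetP => x; rewrite !inE.
have -> : S :|: [set x in a :: s] = a |: (S :|: [set x in s]).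
  by apply/setP => x; rewrite !inE; case: (x == a); case: (x \in S).
rewrite big_cons.
have h1 := f_submod a (finset.subsetUl S [set x in s]).
have h2 := f_mono (finset.subsetUr [set a] S).
rewrite -(leq_add2r (f S)); apply: leq_trans h1 _.
apply: leq_trans (leq_add IH (leqnn _)) _.
move: (\sum_(_ <- _) _) h2 => x; move: (f S) (f (a |: S)) => y z; lia.
Qed.

Lemma submod_max_gain (S U : {set T}) g :
  (forall b, b \notin S -> (f (b |: S) - f S <= g)%N) ->
  (f U - f S <= #|U| * g)%N.
Proof.
move=> hg; have := submod_gain_sum S U.
have := f_mono (finset.subsetUr S U).
suff : (\sum_(a in U) (f (a |: S) - f S) <= #|U| * g)%N by lia.
rewrite -sum_nat_const; apply: leq_sum => a _.
have [aS|aS] := boolP (a \in S); last exact: hg.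
by rewrite (finset.setUidPr _) ?finset.sub1set // subnn.
Qed.
End SubmodularGain.

Section GreedyPotential.
Variable R : realType.

Lemma ln_le_subr1 (x : R) : 0 < x -> ln x <= x - 1.
Proof.
move=> x0; rewrite -[in ln x](subrK 1 x) addrC le_ln1Dx //; lra.
Qed.

(** The integral from 0 to x of min (1, k / t): it bounds the number of greedy steps
    which are needed to remove a deficit x. *)
Definition greedy_potential (k : R) (x : R) : R :=
  if x <= k then x else k + k * ln (x / k).

(** A step removing at least 1 and at least the fraction 1 / k of the deficit decreases
    the potential by 1: the potential is concave and g times its slope at r is
    min (g, g k / r) >= 1. *)
Lemma greedy_potential_step (k r g : R) : 0 < k -> 1 <= g -> g <= r ->
  r <= k * g -> greedy_potential k (r - g) + 1 <= greedy_potential k r.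
Proof.
move=> k0 g1 gr rkg; rewrite /greedy_potential.
have r0 : 0 < r by lra.
have [rk|kr] := leP r k; first by rewrite ifT; lra.
have gkr : 1 <= g * k / r by rewrite ler_pdivlMr // mul1r mulrC.
have [rgk|krg] := leP (r - g) k.
  have -> : ln (r / k) = - ln (k / r) by rewrite -lnV ?posrE ?divr_gt0 // invf_div.
  have : ln (k / r) <= k / r - 1.
    by rewrite ln_le_subr1 ?divr_gt0.
  have kr1 : k / r <= 1 by rewrite ler_pdivrMr // mul1r ltW.
  have : g * k / r <= k - (r - g) + k * (1 - k / r).
    have -> : g * k / r = (k - (r - g)) * (k / r) + k * (1 - k / r).
      by field; rewrite gt_eqF.
    rewrite lerD2r ler_piMr // subr_ge0 //.
  move=> h1 h2; have : k * - ln (k / r) >= k * (1 - k / r) by rewrite ler_pM2l //; lra.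
  lra.
have rg0 : 0 < r - g by lra.
have -> : (r - g) / k = (r - g) / r * (r / k).
  by field; rewrite !gt_eqF.
rewrite lnM ?posrE ?divr_gt0 // mulrDr.
have : ln ((r - g) / r) <= (r - g) / r - 1.
  by rewrite ln_le_subr1 ?divr_gt0.
have -> : (r - g) / r - 1 = - (g / r) by field; rewrite gt_eqF.
rewrite -(ler_pM2l k0) => h; have : k * - (g / r) = - (g * k / r) by ring.
lra.
Qed.
End GreedyPotential.

(** * The greedy stage on the eigenspaces *)

Lemma ln_nat_ge0 (R : realType) m : 0 <= ln (m%:R : R).
Proof.
by case: m => [|m]; [rewrite ln0 | rewrite ln_ge0 // ler1n].
Qed.

Section GreedySelection.
Variables (R : realType) (n : nat) (A : 'M[R]_n).
Variables (pr q : nat) (lam : 'I_(pr + q + q) -> R[i]).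
Variable X : forall i, 'M[R[i]]_(n, mult A lam i).

Notation f := (rank_sum X).
Notation total := (\sum_(i < pr + q + q) mult A lam i)%N.

Lemma rank_sum_mono (S U : {set 'I_n}) : S \subset U -> (f S <= f U)%N.
Proof. by move=> SU; apply: leq_sum => i _; apply: rank_cols_in_mono. Qed.

Lemma rank_sum_submod (S U : {set 'I_n}) a : S \subset U ->
  (f (a |: U) + f S <= f U + f (a |: S))%N.
Proof.
move=> SU; rewrite /rank_sum -!big_split /=.
by apply: leq_sum => i _; apply: rank_cols_in_submod.
Qed.

Lemma rank_sum_le_total S : (f S <= total)%N.
Proof. by apply: leq_sum => i _; apply: rank_leq_row. Qed.

Lemma rank_sum_eq_total S :
  (f S = total) <-> forall i, row_free (cols_in S (X i)^T).
Proof.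
have := leqif_sum (fun (i : 'I_(pr + q + q)) (_ : true) =>
  leqif_eq (rank_leq_row (cols_in S (X i)^T))).
case=> _ e; split.
  by move/eqP; rewrite /rank_sum e => /forallP h i; exact: (h i).
by move=> h; apply/eqP; rewrite /rank_sum e; apply/forallP => i; exact: h.
Qed.

(** One greedy step decreases the deficit r by some g with r <= k g, k being the size of
    a set of maximal rank sum; any Phi which drops by 1 at each such step bounds the
    number of steps. *)
Lemma greedy_potential_bound (Phi : nat -> R) (Sopt S : {set 'I_n}) :
  (forall r g, (0 < r)%N -> (g <= r)%N -> (r <= #|Sopt| * g)%N ->
     Phi (r - g)%N + 1 <= Phi r) ->
  f Sopt = total -> greedy_reach X S ->
  #|S|%:R + Phi (total - f S)%N <= Phi total.
Proof.
move=> hPhi fopt; elim=> [|{}S a rS IH ltS aS amax].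
  rewrite cards0 add0r; have -> : f finset.set0 = 0%N; last by rewrite subn0.
  apply/eqP; rewrite -leqn0; apply: leq_trans (_ : \sum_(i < pr + q + q) 0 <= _)%N.
    by apply: leq_sum => i _; rewrite (leq_trans (rank_leq_col _)) ?cards0.
  by rewrite big1.
apply: le_trans IH; rewrite cardsU1 aS natrD -addrA addrCA lerD2l addrC.
have mono := rank_sum_mono (finset.subsetUr [set a] S).
have le_tot := rank_sum_le_total (a |: S).
have -> : (total - f (a |: S) = (total - f S) - (f (a |: S) - f S))%N by lia.
apply: hPhi; first by rewrite subn_gt0.
  lia.
rewrite -fopt; apply: submod_max_gain amax.
- exact: rank_sum_mono.
- exact: rank_sum_submod.
Qed.

(** The hypothesis allows the total to be 2 N, as conjugate eigenvalues count twice.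
    For k >= 2 one has ln (2 N / k) <= ln N.  For k = 1 the potential of the general
    argument is too weak, but the first step already removes the whole deficit. *)
Lemma greedy_size N (Sopt S : {set 'I_n}) : (total <= 2 * N)%N ->
  f Sopt = total -> greedy_reach X S ->
  #|S|%:R <= (ln (N%:R : R) + 1) * #|Sopt|%:R.
Proof.
move=> totN fopt rS.
have lnN := ln_nat_ge0 R N.
case k1: (#|Sopt| <= 1)%N.
  (* here a step removes the whole deficit, so counting whether r > 0 is enough *)
  have := @greedy_potential_bound (fun r => (0 < r)%N%:R) Sopt S _ fopt rS.
  case k0: #|Sopt| k1 => [|[|//]] _; rewrite ?mulr0 ?mulr1.
    have := @greedy_potential_bound (fun=> 0) Sopt S _ fopt rS.
    rewrite addr0 k0 => H _; apply: H => r g r0 _.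
    by rewrite mul0n leqn0 (gtn_eqF r0).
  move=> H; apply: (@le_trans _ _ 1); last by rewrite lerDr.
  apply: (@le_trans _ _ (0 < total)%N%:R); last by rewrite lern1 leq_b1.
  apply: le_trans (H _); first by rewrite lerDl ler0n.
  move=> r g r0 gr; rewrite mul1n => rg.
  by rewrite (eqP (_ : r - g == 0)%N) ?subn_eq0 // add0r r0.
have k2 : (1 < #|Sopt|)%N by rewrite ltnNge k1.
set k := #|Sopt| in k2 *.
have k0 : 0 < k%:R :> R by rewrite ltr0n (ltn_trans _ k2).
have H : #|S|%:R + greedy_potential k%:R (total - f S)%:R <=
    greedy_potential (k%:R : R) total%:R.
  apply: (greedy_potential_bound (Phi := fun r => greedy_potential k%:R r%:R) _ fopt rS).
  move=> r g r0 gr rkg; rewrite natrB //; apply: greedy_potential_step => //.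
  - by rewrite ler1n; case: g gr rkg => //; rewrite muln0 leqn0 (gtn_eqF r0).
  - by rewrite ler_nat.
  - by rewrite -natrM ler_nat.
have pot0 m : 0 <= greedy_potential (k%:R : R) m%:R.
  rewrite /greedy_potential; case: (leP m%:R) => [_|km]; first exact: ler0n.
  by rewrite addr_ge0 ?ler0n // mulr_ge0 ?ler0n // ln_ge0 // ler_pdivlMr // mul1r ltW.
apply: le_trans (le_trans _ H) _; first by rewrite lerDl.
rewrite mulrDl mul1r addrC /greedy_potential.
case: (leP total%:R) => [tk|kt]; first by rewrite (le_trans tk) // lerDl mulr_ge0 // ltW.
rewrite lerD2l mulrC ler_pM2r // ler_ln ?posrE ?divr_gt0 //.
- rewrite ler_pdivrMr // -natrM ler_nat (leq_trans totN) // mulnC leq_mul2l k2 orbT //.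
- by apply: lt_trans kt.
- rewrite ltr0n; case: N totN {lnN} => // ; rewrite muln0 leqn0 => /eqP t0.
  by move: kt; rewrite t0 ltNge ler0n.
Qed.

Hypothesis hX : forall i, left_null_basis (X i).

Lemma rank_sum_setT : f [set: 'I_n] = total.
Proof.
apply: eq_bigr => i _; rewrite rank_cols_in_full.
by have [/eqP] := hX i.
Qed.

Lemma greedy_output_exists : exists S, greedy_output X S.
Proof.
suff H m S : (#|~: S| <= m)%N -> greedy_reach X S -> exists S, greedy_output X S.
  exact: H (leqnn _) (Greedy_init X).
elim: m S => [|m IH] S Sm rS.
all: have [ltS|geS] := boolP (f S < total)%N; last by exists S.
all: have [S0|[a]] := finset.set_0Vmem (~: S); first by
  move: ltS; rewrite -(finset.setCK S) S0 finset.setC0 rank_sum_setT ltnn.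
  by move=> aS; move: Sm; rewrite leqn0 cards_eq0 => /eqP S0; rewrite S0 inE in aS.
rewrite inE => aS.
case: (@arg_maxnP _ a (fun b => b \notin S) (fun b => f (b |: S) - f S)%N aS) => b bS bmax.
apply: (IH (b |: S)); last exact: Greedy_step.
rewrite -ltnS (leq_trans _ Sm) // proper_card //.
by rewrite properC finset.properUr // finset.sub1set.
Qed.

Lemma greedy_output_total S : greedy_output X S -> f S = total.
Proof.
by case=> _; rewrite -leqNgt => h; apply/eqP; rewrite eqn_leq rank_sum_le_total.
Qed.

Lemma greedy_output_bases S : greedy_output X S ->
  exists h : 'I_(pr + q) -> {set 'I_n},
    forall i, h i \in Hset X (lshift q i) /\ h i \subset S.
Proof.
move/greedy_output_total/rank_sum_eq_total => fS.
suff H (i : 'I_(pr + q)) : exists J, J \in Hset X (lshift q i) /\ J \subset S.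
  by have [h hh] := choice H; exists h.
have [J JS [cJ rJ]] := rank_cols_in_basis (X (lshift q i))^T S.
exists J; split => //; rewrite inE; apply/andP; split.
  by rewrite cJ; exact: fS.
by rewrite /row_free rJ; exact: fS.
Qed.
End GreedySelection.

Section SpectrumFacts.
Variables (R : realType) (n : nat) (A : 'M[R]_n).
Variables (pr q : nat) (lam : 'I_(pr + q + q) -> R[i]).
Hypothesis hlam : spectrum_ordering A lam.

Lemma mult_kermx i : mult A lam i = \rank (kermx ((lam i)%:M - cplx_mx A)).
Proof. by rewrite mxrank_ker. Qed.

Lemma left_null_basis_exists :
  exists X : forall i, 'M[R[i]]_(n, mult A lam i), forall i, left_null_basis (X i).
Proof.
suff H i : {X : 'M[R[i]]_(n, mult A lam i) | left_null_basis X}.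
  by exists (fun i => sval (H i)) => i; exact: (svalP (H i)).
apply: cid.
suff [Y [fY eY]] : exists Y : 'M[R[i]]_(mult A lam i, n),
    row_free Y /\ (Y == kermx ((lam i)%:M - cplx_mx A))%MS.
  by exists Y^T; rewrite /left_null_basis trmxK.
rewrite mult_kermx; exists (row_base (kermx ((lam i)%:M - cplx_mx A))).
by rewrite row_base_free; split => //; apply/eqmxP; exact: eq_row_base.
Qed.

Lemma cplx_mx_conj : map_mx Num.conj (cplx_mx A) = cplx_mx A.
Proof.
apply/matrixP => i j; rewrite !mxE conj_Creal //.
by apply/complex_realP; exists (A i j).
Qed.

Lemma mult_conj (j : 'I_q) :
  mult A lam (rshift (pr + q) j) = mult A lam (lshift q (rshift pr j)).
Proof.
have [_ _ _ /(_ j) [_ e]] := hlam.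
rewrite /mult /geo_mult e; congr (_ - _)%N.
rewrite -[RHS](mxrank_map Num.conj) map_mxB cplx_mx_conj map_scalar_mx //.
Qed.

Lemma sum_mult_le : (\sum_(i < pr + q + q) mult A lam i <= 2 * Nmult A lam)%N.
Proof.
rewrite big_split_ord /= mul2n -addnn leq_add //.
rewrite /Nmult big_split_ord /= -[leqLHS]add0n leq_add //.
by rewrite leq_eqVlt; apply/orP; left; apply/eqP/eq_bigr => j _; rewrite mult_conj.
Qed.

(** Eigenspaces for distinct eigenvalues are in direct sum. *)
Lemma Nmult_le : (Nmult A lam <= n)%N.
Proof.
have inj : {in predT &, injective (fun i : 'I_(pr + q) => lam (lshift q i))}.
  by case: hlam => lam_inj _ _ _ i j _ _ /lam_inj /lshift_inj.
have /mxdirectP /= e := mxdirect_sum_eigenspace (cplx_mx A) inj.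
apply: leq_trans (rank_leq_col (\sum_(i < pr + q)
  eigenspace (cplx_mx A) (lam (lshift q i)))%MS); rewrite e.
apply: leq_sum => i _; rewrite /rmult mult_kermx; apply: mxrankS.
apply/rV_subP => v /sub_kermxP; rewrite mulmxBr mul_mx_scalar => /eqP.
by rewrite subr_eq0 => /eqP e'; apply/eigenspaceP.
Qed.

Lemma rmult_le_kmax i : (rmult A lam i <= kmax A lam)%N.
Proof. exact: (leq_bigmax (lshift q i)). Qed.
End SpectrumFacts.

(** * Feasible configurations *)

(** A maximal minor which is nonzero at one end of the segment is a nonzero polynomial
    along the line; here the minor is taken after multiplication by a right inverse. *)
Lemma row_free_on_line (F : fieldType) k l (M0 M1 : 'M[F]_(k, l)) :
  row_free M0 \/ row_free M1 ->
  exists2 p : {poly F}, p != 0 &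
    forall t, p.[t] != 0 -> row_free ((1 - t) *: M0 + t *: M1).
Proof.
move=> hM.
have [D hD] : exists D : 'M[F]_(l, k), M0 *m D = 1%:M \/ M1 *m D = 1%:M.
  by case: hM => /row_freeP [D hD]; exists D; [left|right].
pose P := (1 - 'X) *: map_mx polyC (M0 *m D) + 'X *: map_mx polyC (M1 *m D).
have evalP t : (\det P).[t] = \det (((1 - t) *: M0 + t *: M1) *m D).
  rewrite -[LHS]/(horner_eval t _) -det_map_mx; congr (\det _).
  rewrite mulmxDl -!scalemxAl; apply/matrixP => i j.
  by rewrite /P !mxE /= /horner_eval !hornerE.
exists (\det P).
  apply/eqP => P0; case: hD => hD.
    by have := evalP 0; rewrite P0 horner0 subr0 scale1r scale0r addr0 hD det1 => /eqP;
       rewrite eq_sym oner_eq0.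
  by have := evalP 1; rewrite P0 horner0 subrr scale1r scale0r add0r hD det1 => /eqP;
     rewrite eq_sym oner_eq0.
move=> t; rewrite evalP => h; apply/row_freeP.
have /mulmxV hE : ((1 - t) *: M0 + t *: M1) *m D \in unitmx by rewrite unitmxE unitfE.
by exists (D *m invmx (((1 - t) *: M0 + t *: M1) *m D)); rewrite mulmxA.
Qed.

Lemma poly_nat_nonroot (F : numFieldType) (p : {poly F}) :
  p != 0 -> exists m : nat, p.[m%:R] != 0.
Proof.
move=> p0; apply/not_existsP => h.
have := max_poly_roots (rs := [seq m%:R | m <- iota 0 (size p)]) p0.
rewrite size_map size_iota ltnn => H; apply: notF; apply: H.
  apply/allP => _ /mapP [m _ ->]; apply/negPn/negP => r; exact: (h m).
by rewrite map_inj_uniq ?iota_uniq // => x y /eqP; rewrite eqr_nat => /eqP.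
Qed.

Section Feasibility.
Variables (R : realType) (n l : nat) (A : 'M[R]_n).
Variables (pr q : nat) (lam : 'I_(pr + q + q) -> R[i]).
Variable X : forall i, 'M[R[i]]_(n, mult A lam i).
Hypothesis hX : forall i, left_null_basis (X i).

Notation cmx := (map_mx (real_complex R)).

Lemma left_null_basisP i (v : 'rV[R[i]]_n) :
  v *m cplx_mx A = lam i *: v <-> exists w, v = w *m (X i)^T.
Proof.
have e : (v *m cplx_mx A == lam i *: v) = (v <= (X i)^T)%MS.
  rewrite (eqmxP (hX i).2) sub_kermx mulmxBr mul_mx_scalar subr_eq0 eq_sym //.
split; first by move/eqP; rewrite e => /submxP.
by move=> [w vw]; apply/eqP; rewrite e vw submxMl.
Qed.

Definition row_support (Bbar : 'M[bool]_(n, l)) : {set 'I_n} :=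
  [set a | [exists j, Bbar a j]].

Lemma card_row_support Bbar : (#|row_support Bbar| <= nnz Bbar)%N.
Proof.
apply: leq_trans (leq_imset_card (fun ij : 'I_n * 'I_l => ij.1) _).
apply: subset_leq_card; apply/fintype.subsetP => a; rewrite inE => /existsP [j aj].
by apply/imsetP; exists (a, j); rewrite ?inE.
Qed.

(** If w kills the columns of X_i^T indexed by the nonzero rows of B, then w X_i^T is a
    left eigenvector killed by B. *)
Lemma feasible_rank_sum Bbar : feasible A Bbar ->
  rank_sum X (row_support Bbar) = (\sum_(i < pr + q + q) mult A lam i)%N.
Proof.
case=> B hB /controllable_hautus hH; apply/rank_sum_eq_total => i.
apply: inj_row_free => w hw.
have wX0 : w *m (X i)^T = 0.
  apply: (hH (lam i)); first by apply/left_null_basisP; exists w.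
  apply/rowP => j; rewrite !mxE; apply: big1 => a _.
  have [aS|aS] := boolP (a \in row_support Bbar).
    move/rowP/(_ (enum_rank_in aS a)): hw; rewrite mxE [RHS]mxE => hw.
    suff -> : (w *m (X i)^T) 0 a = 0 by rewrite mul0r.
    rewrite mxE -[RHS]hw; apply: eq_bigr => b _.
    by rewrite [X in _ = _ * X]mxE enum_rankK_in.
  rewrite [X in _ * X]mxE hB ?mulr0 //.
  by apply: contra aS => aj; rewrite inE; apply/existsP; exists j.
have [/row_freeP [D hD] _] := hX i.
by rewrite -[w]mulmx1 -hD mulmxA wX0 mul0mx.
Qed.

Hypothesis hlam : spectrum_ordering A lam.

(** The conjugate of a left eigenvector is a left eigenvector for the conjugate
    eigenvalue, because A and B are real. *)
Lemma hautus_representatives (B : 'M[R]_(n, l)) :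
  (forall i : 'I_(pr + q), row_free ((X (lshift q i))^T *m cmx B)) -> hautus A B.
Proof.
move=> hB a v va vB; apply/eqP; apply: contraT => v0.
have [_ spec _ hconj] := hlam.
have : eigenvalue (cplx_mx A) a by apply/eigenvalueP; exists v.
case/spec => i ei; suff : v = 0 by move/eqP; rewrite (negPf v0).
have rep (k : 'I_(pr + q)) (u : 'rV[R[i]]_n) : u *m cplx_mx A = lam (lshift q k) *: u ->
    u *m cmx B = 0 -> u = 0.
  move=> /left_null_basisP [w ->]; rewrite -mulmxA => w0.
  by have /row_freeP [D hD] := hB k; rewrite -[w]mulmx1 -hD (mulmxA w) w0 !mul0mx.
case: (split_ordP i) => [k|k] ek; rewrite ek in ei.
  by apply: (rep k) => //; rewrite ei.
have conjB m s (M : 'M[R]_(m, s)) : map_mx Num.conj (cmx M) = cmx M.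
  apply/matrixP => x y; rewrite !mxE conj_Creal //.
  by apply/complex_realP; exists (M x y).
have vA' : map_mx Num.conj v *m cplx_mx A =
    lam (lshift q (rshift pr k)) *: map_mx Num.conj v.
  rewrite -[cplx_mx A]conjB -map_mxM va map_mxZ -ei; congr (_ *: _).
  by rewrite (hconj k).2; exact: conjCK.
have v'0 := rep _ _ vA' _.
have {}v'0 : map_mx Num.conj v = 0.
  by apply: v'0; rewrite -[cmx B]conjB -map_mxM vB map_mx0.
apply/rowP => j; move/rowP/(_ j)/eqP: v'0; rewrite !mxE conjC_eq0 => /eqP //.
Qed.

(** Eigenvalues are treated one after the other: if B works for the previous ones and
    B' for the new one, almost every point of the line through B and B' works for all
    of them.  The parameter is taken among natural numbers to keep B real. *)
Lemma generic_feasible (Bbar : 'M[bool]_(n, l)) :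
  (forall i : 'I_(pr + q), exists2 B : 'M[R]_(n, l),
     forall a j, ~~ Bbar a j -> B a j = 0 & row_free ((X (lshift q i))^T *m cmx B)) ->
  feasible A Bbar.
Proof.
move=> hgen.
suff H (s : seq 'I_(pr + q)) : exists2 B : 'M[R]_(n, l),
     forall a j, ~~ Bbar a j -> B a j = 0 &
     forall i, i \in s -> row_free ((X (lshift q i))^T *m cmx B).
  have [B B0 hB] := H (enum 'I_(pr + q)).
  exists B => //; apply/hautus_controllable/hautus_representatives => i.
  by apply: hB; rewrite mem_enum.
elim: s => [|i s [B B0 hB]]; first by exists 0 => // a j _; rewrite mxE.
have [B' B'0 hB'] := hgen i.
have H k : exists p : {poly R[i]}, p != 0 /\ (k \in i :: s -> forall t, p.[t] != 0 ->
    row_free ((1 - t) *: ((X (lshift q k))^T *m cmx B) +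
              t *: ((X (lshift q k))^T *m cmx B'))).
  have [ks|ks] := boolP (k \in i :: s); last by exists 1; rewrite oner_eq0.
  have [|p p0 hp] := @row_free_on_line _ _ _ ((X (lshift q k))^T *m cmx B)
    ((X (lshift q k))^T *m cmx B'); last by exists p.
  by move: ks; rewrite inE => /predU1P [->|ks]; [right|left; exact: hB].
have [P hP] := choice H.
have [|m hm] := @poly_nat_nonroot _ (\prod_k P k).
  by apply/prodf_neq0 => k _; have [] := hP k.
exists ((1 - m%:R) *: B + m%:R *: B').
  by move=> a j aj; rewrite !mxE B0 // B'0 // !mulr0 addr0.
move=> k ks; have [_ /(_ ks m%:R)] := hP k.
rewrite map_mxD !map_mxZ mulmxDr -!scalemxAr rmorphB rmorph1 rmorph_nat; apply.
by move: hm; rewrite horner_prod => /prodf_neq0; apply.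
Qed.

Lemma matching_feasible (h : 'I_(pr + q) -> {set 'I_n}) (Bbar : 'M[bool]_(n, l)) :
  (forall i, h i \in Hset X (lshift q i)) ->
  (forall i, exists2 m : 'I_n -> 'I_l, {in h i &, injective m} &
     forall a, a \in h i -> Bbar a (m a)) ->
  feasible A Bbar.
Proof.
move=> hh hm; apply: generic_feasible => i.
have [m minj mB] := hm i.
exists (\matrix_(a, j) ((a \in h i) && (m a == j))%:R).
  move=> a j; rewrite mxE; case: (boolP (a \in h i)) => //= ai.
  by case: eqP => // <-; rewrite mB.
apply: inj_row_free => w; rewrite mulmxA => hw.
have /andP [_ /row_freeP [D hD]] : (#|h i| == mult A lam (lshift q i)) &&
  row_free (cols_in (h i) (X (lshift q i))^T) by have := hh i; rewrite inE.
rewrite -[w]mulmx1 -hD mulmxA; suff -> : w *m cols_in (h i) (X (lshift q i))^T = 0.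
  by rewrite mul0mx.
apply/rowP => j; set a := enum_val j; have ai : a \in h i := enum_valP j.
move/rowP/(_ (m a)): hw; rewrite !mxE (bigD1 a) //= big1 ?addr0; last first.
  move=> b ba; rewrite !mxE; case: (boolP (b \in h i)) => bi /=; rewrite ?rmorph0 ?mulr0 //.
  case: eqP => [/minj e|_]; last by rewrite rmorph0 mulr0.
  by rewrite e ?eqxx in ba.
rewrite [X in _ * X]mxE !mxE ai eqxx rmorph1 mulr1 => hw.
by rewrite -[RHS]hw; apply: eq_bigr => b _; rewrite !mxE.
Qed.
End Feasibility.

(** * The coloring stage *)

(** Elements outside M have disjoint sets of choices, so they are served first; an
    element of M has as many choices as there are elements to serve. *)
Lemma distinct_representatives (T L : finType) (H M : {set T}) (c : T -> {set L}) (x0 : L) :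
  (forall a, a \in H -> a \notin M -> c a != finset.set0) ->
  (forall a b, a \in H -> b \in H -> a \notin M -> b \notin M -> a != b ->
     [disjoint c a & c b]) ->
  (forall a, a \in H -> a \in M -> (#|H| <= #|c a|)%N) ->
  exists2 m : T -> L, {in H &, injective m} & forall a, a \in H -> m a \in c a.
Proof.
move=> c_neq0 c_disj c_big.
suff [m [minj mc]] : exists m : T -> L,
    {in (H :\: M) :|: [set a in enum (H :&: M)] &, injective m} /\
    forall a, a \in (H :\: M) :|: [set a in enum (H :&: M)] -> m a \in c a.
  have HE a : a \in H -> a \in (H :\: M) :|: [set a in enum (H :&: M)].
    by move=> aH; rewrite !inE mem_enum inE aH andbT andTb orNb.
  by exists m => [a b /HE aH /HE bH|a /HE]; [exact: minj|exact: mc].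
have sub : {subset enum (H :&: M) <= H :&: M} by move=> a; rewrite mem_enum.
elim: (enum _) (enum_uniq (H :&: M)) sub => [_ _|a s IH /= /andP [as_ us] sub].
  exists (fun a => odflt x0 [pick x in c a]).
  have pickc a : a \in (H :\: M) :|: [set a in [::]] -> odflt x0 [pick x in c a] \in c a.
    rewrite !inE orbF => /andP [aM aH]; case: pickP => //= c0.
    by case/set0Pn: (c_neq0 a aH aM) => x; rewrite c0.
  split=> // a b aS bS eab; apply/eqP; apply: contraT => ab.
  have := aS; have := bS; rewrite !inE !orbF => /andP [bM bH] /andP [aM aH].
  have /pred0P/(_ (odflt x0 [pick x in c a])) := c_disj a b aH bH aM bM ab.
  by rewrite /= pickc // eab pickc.
have [|m [minj mc]] := IH us; first by move=> b bs; apply: sub; rewrite inE bs orbT.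
have := sub a (mem_head _ _); rewrite inE => /andP [aH aM].
set T' := (H :\: M) :|: [set a in s] in minj mc.
have aT' : a \notin T' by rewrite !inE aM (negPf as_).
have [y yc yT'] : exists2 y, y \in c a & y \notin m @: T'.
  apply/subsetPn; apply/negP => /subset_leq_card; apply/negP; rewrite -ltnNge.
  apply: leq_ltn_trans (leq_imset_card _ _) (leq_trans _ (c_big a aH aM)).
  apply: proper_card; apply/properP; split; last by exists a.
  apply/fintype.subsetP => b; rewrite !inE => /orP [/andP []//|bs].
  by have := sub b; rewrite !inE bs orbT => /(_ isT) /andP [].
exists (fun b => if b == a then y else m b); split.
  move=> b1 b2; rewrite !inE => b1S b2S.
  have inT' b : b != a ->
      (b \notin M) && (b \in H) || ((b == a) || (b \in s)) -> b \in T'.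
    by move=> /negPf ba; rewrite !inE ba.
  case: eqP => [->|/eqP b1a]; case: eqP => [->|/eqP b2a] // e.
  - by move/negP: yT'; case; rewrite e imset_f // inT'.
  - by move/negP: yT'; case; rewrite -e imset_f // inT'.
  - by apply: minj e; rewrite inT'.
move=> b; rewrite !inE => bS; case: eqP bS => [-> //|/eqP /negPf ba bS].
by apply: mc; rewrite !inE.
Qed.

Section Coloring.
Variables (R : realType) (n : nat) (A : 'M[R]_n).
Variables (pr q : nat) (lam : 'I_(pr + q + q) -> R[i]) (l : nat).
Variable h : 'I_(pr + q) -> {set 'I_n}.
Hypothesis card_h : forall i, #|h i| = rmult A lam i.

Notation coloring := {ffun 'I_n -> {set 'I_l}}.
Notation aux := (aux_graph h).
Notation reach := (coloring_reach A lam h).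

Lemma aux_graph_sym v w : aux v w = aux w v.
Proof. by rewrite /aux_graph eq_sym; under eq_existsb do rewrite andbC. Qed.

Lemma aux_vertex_mult v i : v \in h i -> (0 < rmult A lam i)%N.
Proof. by move=> vi; rewrite -card_h; apply/card_gt0P; exists v. Qed.

Lemma kstar_gt0 v : v \in aux_vertices h -> (0 < kstar A lam h v)%N.
Proof.
case/bigcupP => i _ vi; apply: leq_trans (aux_vertex_mult vi) _.
exact: (@leq_bigmax_cond _ (fun i => v \in h i)).
Qed.

Lemma kstar_le_kmax v : (kstar A lam h v <= kmax A lam)%N.
Proof. by apply/bigmax_leqP => i _; apply: rmult_le_kmax. Qed.

Lemma rmult_le_kstar v i : v \in h i -> (rmult A lam i <= kstar A lam h v)%N.
Proof. by move=> vi; apply: (@leq_bigmax_cond _ (fun i => v \in h i)). Qed.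

Lemma assignE (c : coloring) v C w : assign c v C w = if w == v then C else c w.
Proof. by rewrite ffunE. Qed.

Lemma card_nbr_colors_le (g : rel 'I_n) (c : coloring) v :
  (forall w, g v w -> (#|c w| <= 1)%N) ->
  (#|nbr_colors g c v| <= #|[set w | g v w & c w != finset.set0]|)%N.
Proof.
move=> c1; rewrite -(card_imset _ (@Some_inj _)).
apply: leq_trans (leq_imset_card (fun w => [pick x in c w]) _).
apply: subset_leq_card; apply/fintype.subsetP => _ /imsetP [x /bigcupP [w gw xw] ->].
apply/imsetP; exists w; first by rewrite inE gw; apply/set0Pn; exists x.
case: pickP => [y yw|/(_ x)]; last by rewrite xw.
by congr Some; apply/eqP; move/card_le1P: (c1 w gw) => /(_ x xw y); rewrite yw inE eq_sym.
Qed.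

(** M is the set of the vertices whose edges have been removed.  The last clause records
    that a first removal needs l neighbors with one color each, and that such vertices
    keep their color. *)
Definition coloring_inv (g : rel 'I_n) (c : coloring) (M : {set 'I_n}) : Prop :=
  [/\ forall v w, g v w = [&& aux v w, v \notin M & w \notin M],
      forall v, v \in M -> v \in aux_vertices h /\ #|c v| = kstar A lam h v,
      forall v, v \notin M -> (#|c v| <= 1)%N,
      forall v w, v \notin M -> w \notin M -> aux v w -> [disjoint c v & c w]
    & (forall v, c v != finset.set0 -> v \in aux_vertices h) /\
      (M != finset.set0 -> (l <= #|[set v | v \notin M & c v != finset.set0]|)%N)].

Lemma coloring_reach_inv g c : reach g c -> exists M, coloring_inv g c M.
Proof.
elim=> [|{}g {}c v C _ [M [gE cM c1 cd [caux cl]]] [unc _] nl cC|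
        {}g {}c v x _ [M [gE cM c1 cd [caux cl]]] [unc _] nl xn _].
- exists finset.set0; split => [v w|v|v _|v w _ _ _|]; rewrite ?inE ?andbT //.
  + by rewrite ffunE cards0.
  + by rewrite !ffunE -setI_eq0 finset.set0I.
  + by split=> [v|]; rewrite ?ffunE eqxx.
- have /andP [va /eqP cv0] := unc.
  have vM : v \notin M.
    by apply/negP => /cM [_]; rewrite cv0 cards0 => /esym/eqP; rewrite gtn_eqF ?kstar_gt0.
  exists (v |: M); split.
  + move=> u w; rewrite /isolate gE !inE !negb_or.
    by case: (aux u w); case: (u == v); case: (w == v); case: (u \in M); case: (w \in M).
  + move=> u /setU1P [->|uM]; first by rewrite assignE eqxx.
    by rewrite assignE; case: eqP => [e|_]; [rewrite -e uM in vM|exact: cM].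
  + by move=> u; rewrite !inE negb_or assignE => /andP [/negPf -> /c1].
  + move=> u w; rewrite !inE !negb_or !assignE => /andP [/negPf -> uM] /andP [/negPf -> wM].
    exact: cd.
  + split=> [u|_]; first by rewrite assignE; case: (u =P v) => [-> //|_]; exact: caux.
    apply: (@leq_trans #|nbr_colors g c v|); first by rewrite nl.
    apply: leq_trans (card_nbr_colors_le _) _.
      by move=> w; rewrite gE => /and3P [_ _ /c1].
    apply: subset_leq_card; apply/fintype.subsetP => w.
    rewrite !inE gE => /andP [/and3P [_ _ wM] wc]; rewrite negb_or wM andbT assignE.
    by case: (w =P v) wc => [->|//]; rewrite cv0 eqxx.
- have /andP [va /eqP cv0] := unc.
  have vM : v \notin M.
    by apply/negP => /cM [_]; rewrite cv0 cards0 => /esym/eqP; rewrite gtn_eqF ?kstar_gt0.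
  exists M; split => //.
  + by move=> u uM; rewrite assignE; case: eqP => [e|_]; [rewrite -e uM in vM|exact: cM].
  + by move=> u uM; rewrite assignE; case: eqP => _; [rewrite cards1|exact: c1].
  + have xd w : w \notin M -> aux v w -> [disjoint [set x] & c w].
      move=> wM vw; rewrite disjoints1; apply: contra xn => xw.
      by apply/bigcupP; exists w => //; rewrite gE vw vM.
    move=> u w uM wM uw; rewrite !assignE.
    case: eqP => [e|_]; case: eqP => [e'|_]; last exact: cd.
    - by move: uw; rewrite e e' /aux_graph eqxx.
    - by apply: xd => //; rewrite -e.
    - by rewrite disjoint_sym; apply: xd => //; rewrite -e' aux_graph_sym.
  + split=> [u|M0]; first by rewrite assignE; case: (u =P v) => [-> //|_]; exact: caux.
    apply: leq_trans (cl M0) _; apply: subset_leq_card; apply/fintype.subsetP => w.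
    rewrite !inE assignE => /andP [-> wc] /=; case: (w =P v) => // _.
    by apply/set0Pn; exists x; rewrite inE.
Qed.

Lemma coloring_output_colored (c : coloring) v :
  coloring_output A lam h c -> v \in aux_vertices h -> c v != finset.set0.
Proof. by case=> _ /(_ v); rewrite negb_and => /orP [/negPf ->|]. Qed.

(** The vertices of the clique h i which kept their edges have disjoint nonempty sets of
    colors; each of the others received at least k_i = |h i| colors.  The vertex a0
    supplies a default color. *)
Lemma coloring_output_matching (c : coloring) i a0 :
  coloring_output A lam h c -> a0 \in h i ->
  exists2 m : 'I_n -> 'I_l, {in h i &, injective m} & forall a, a \in h i -> m a \in c a.
Proof.
move=> hc a0i; have [[g /coloring_reach_inv [M [gE cM c1 cd _]]] _] := hc.
have in_aux a : a \in h i -> a \in aux_vertices h by move=> ai; apply/bigcupP; exists i.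
have /set0Pn [x0 _] := coloring_output_colored hc (in_aux a0 a0i).
apply: (@distinct_representatives _ _ (h i) M c x0).
- by move=> a ai _; apply: coloring_output_colored hc (in_aux a ai).
- move=> a b ai bi aM bM ab; apply: cd => //; rewrite /aux_graph ab /=.
  by apply/existsP; exists i; rewrite ai bi.
- by move=> a ai /cM [_ ->]; rewrite card_h rmult_le_kstar.
Qed.

Lemma nnz_output_config (c : coloring) : nnz (output_config c) = (\sum_v #|c v|)%N.
Proof.
rewrite /nnz -sum1_card (eq_bigl (fun ij : 'I_n * 'I_l => ij.2 \in c ij.1)); last first.
  by move=> ij; rewrite inE mxE.
rewrite -(pair_big_dep xpredT (fun i j => j \in c i) (fun _ _ => 1%N)) /=.
by apply: eq_bigr => v _; rewrite sum1_card.
Qed.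

Lemma nnz_le_single (c : coloring) : coloring_output A lam h c ->
  ~ multicolored c -> (nnz (output_config c) <= #|aux_vertices h|)%N.
Proof.
move=> [[g /coloring_reach_inv [M [_ _ _ _ [caux _]]]] _] nm.
rewrite nnz_output_config -sum1_card [leqRHS]big_mkcond; apply: leq_sum => v _.
have [va|va] := boolP (v \in _); first by rewrite leqNgt; apply/negP => H; apply: nm; exists v.
by rewrite leqn0 cards_eq0; apply: contraNT va; exact: caux.
Qed.

Lemma nnz_le_kmax (c : coloring) : coloring_output A lam h c ->
  (nnz (output_config c) <= kmax A lam * #|aux_vertices h|)%N.
Proof.
move=> [[g /coloring_reach_inv [M [_ cM c1 _ [caux _]]]] _].
rewrite nnz_output_config mulnC -sum_nat_const [leqRHS]big_mkcond; apply: leq_sum => v _.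
have [va|va] := boolP (v \in _); last first.
  by rewrite leqn0 cards_eq0; apply: contraNT va; exact: caux.
have [/cM [_ ->]|/c1 H] := boolP (v \in M); first exact: kstar_le_kmax.
exact: leq_trans H (leq_trans (kstar_gt0 va) (kstar_le_kmax v)).
Qed.

(** There are at least l vertices with one color, and the others have at most kmax. *)
Lemma nnz_le_multi (c : coloring) : coloring_output A lam h c -> multicolored c ->
  (nnz (output_config c) + (kmax A lam).-1 * l <= kmax A lam * #|aux_vertices h|)%N /\
  (0 < kmax A lam)%N.
Proof.
move=> [[g /coloring_reach_inv [M [_ cM c1 _ [caux cl]]]] _] [v cv].
have vM : v \in M by apply: contraLR cv => /c1; rewrite leqNgt.
have k0 : (0 < kmax A lam)%N.
  exact: leq_trans (kstar_gt0 (cM v vM).1) (kstar_le_kmax v).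
split => //; set W := [set v | v \notin M & c v != finset.set0] in cl.
have lW : (l <= #|W|)%N by apply: cl; apply/set0Pn; exists v.
have WM : (#|W| + #|M| <= #|aux_vertices h|)%N.
  have d : W :&: M = finset.set0.
    by apply/setP => w; rewrite !inE; case: (w \in M); rewrite ?andbF.
  rewrite -cardsUI d cards0 addn0; apply: subset_leq_card; apply/fintype.subsetP => w.
  by rewrite !inE => /orP [/andP [_ /caux]//|/cM []].
have : (nnz (output_config c) <= #|W| + #|M| * kmax A lam)%N.
  rewrite nnz_output_config -sum1_card -sum_nat_const.
  rewrite [X in (_ <= X + _)%N]big_mkcond [X in (_ <= _ + X)%N]big_mkcond.
  rewrite -big_split /=; apply: leq_sum => w _; rewrite inE.
  have [/cM [_ ->]|/c1 H] := boolP (w \in M); first by rewrite kstar_le_kmax.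
  by case: (c w =P finset.set0) => [->|_]; rewrite ?cards0 // addn0.
have : ((kmax A lam).-1 * l <= (kmax A lam).-1 * #|W|)%N by rewrite leq_mul2l lW orbT.
have : (kmax A lam * (#|W| + #|M|) <= kmax A lam * #|aux_vertices h|)%N.
  by rewrite leq_mul2l WM orbT.
case: (kmax A lam) k0 => // k _ /=; nia.
Qed.

(** A selected vertex can always be colored: kmax <= l leaves enough colors when all of
    them are seen, and otherwise a color is missing around the vertex. *)
Lemma coloring_output_exists : (kmax A lam <= l)%N ->
  exists c : coloring, coloring_output A lam h c.
Proof.
move=> kmax_l; suff H m (g : rel 'I_n) (c : coloring) :
    (#|[set v | uncolored h c v]| <= m)%N -> reach g c ->
    exists c : coloring, coloring_output A lam h c.
  exact: H (leqnn _) (Coloring_init A lam l h).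
elim: m g c => [|m IH] g c cm rc.
all: have [[v vU]|noU] := pselect (exists v, uncolored h c v); last by
  exists c; split; [exists g|move=> v; apply/negP => vU; apply: noU; exists v].
  by move: cm; rewrite leqn0 cards_eq0 => /eqP/setP/(_ v); rewrite !inE vU.
case: (@arg_maxnP _ v (fun v => uncolored h c v) (fun v => #|nbr_colors g c v|) vU).
move=> {vU}v vU vmax.
have sel : selectable h g c v by split.
have va : v \in aux_vertices h by case/andP: vU.
have step (C : {set 'I_l}) : C != finset.set0 ->
    (#|[set w | uncolored h (assign c v C) w]| <= m)%N.
  move=> C0; rewrite -ltnS (leq_trans _ cm) // proper_card //.
  apply/properP; split; last by exists v; rewrite !inE // /uncolored assignE eqxx va.
  apply/fintype.subsetP => w; rewrite !inE /uncolored assignE.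
  by case: (w =P v) => [_|//]; rewrite (negPf C0) andbF.
have [nl|/eqP nl] := eqVneq #|nbr_colors g c v| l.
  have kl : (kstar A lam h v <= l)%N := leq_trans (kstar_le_kmax v) kmax_l.
  pose C := [set widen_ord kl i | i : 'I_(kstar A lam h v)].
  have cC : #|C| = kstar A lam h v.
    by rewrite card_imset ?card_ord // => i j /(congr1 val) /= e; apply: val_inj.
  apply: (IH _ _ (step C _) (Coloring_multi rc sel nl cC)).
  by rewrite -card_gt0 cC kstar_gt0.
have [y yn] : exists y, y \notin nbr_colors g c v.
  apply/existsP; rewrite -negb_forall; apply/negP => /forallP H; apply: nl.
  rewrite (_ : nbr_colors g c v = [set: 'I_l]) ?cardsT ?card_ord //.
  by apply/setP => z; rewrite H inE.
case: (@arg_minnP _ y (fun y => y \notin nbr_colors g c v)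
  (fun y => #|y |: used_colors c|) yn) => x xn xmin.
apply: (IH _ _ (step [set x] _) (Coloring_single rc sel nl xn xmin)).
by apply/set0Pn; exists x; rewrite inE.
Qed.

End Coloring.

(** * Colorings with one color per vertex *)

Section SingleColoring.
Variables (R : realType) (n : nat) (A : 'M[R]_n).
Variables (pr q : nat) (lam : 'I_(pr + q + q) -> R[i]) (l : nat).
Variable h : 'I_(pr + q) -> {set 'I_n}.
Hypothesis card_h : forall i, #|h i| = rmult A lam i.

Notation coloring := {ffun 'I_n -> {set 'I_l}}.
Notation aux := (aux_graph h).
Notation reach := (coloring_reach A lam h).

(** While no vertex sees all the l colors, no edge is removed, so the current graph is
    the auxiliary graph and each vertex has at most one color. *)
Lemma single_coloring_ind (Inv : coloring -> Prop) :
  Inv [ffun=> finset.set0] ->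
  (forall c v, Inv c -> (forall w, (#|c w| <= 1)%N) -> selectable h aux c v ->
     #|nbr_colors aux c v| <> l) ->
  (forall c v x, Inv c -> (forall w, (#|c w| <= 1)%N) -> selectable h aux c v ->
     Inv (assign c v [set x])) ->
  forall c : coloring, coloring_output A lam h c -> ~ multicolored c.
Proof.
move=> inv0 nomulti step c [[g rc] _].
suff [_ [c1 _]] : g = aux /\ (forall w, (#|c w| <= 1)%N) /\ Inv c.
  by move=> [v]; rewrite ltnNge c1.
elim: rc => [|{}g {}c v C _ [-> [c1 ic]] sel nl _|{}g {}c v x _ [-> [c1 ic]] sel _ _ _].
- by split => //; split => // w; rewrite ffunE cards0.
- by have := nomulti c v ic c1 sel.
- split=> //; split; last exact: step.
  by move=> w; rewrite assignE; case: eqP => // _; rewrite cards1.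
Qed.

Definition colored_nbrs (c : coloring) v := [set w | aux v w & c w != finset.set0].

(** Edges as two-element sets, so that they are counted by binomial coefficients. *)
Definition clique_edges (D : pred 'I_(pr + q)) : {set {set 'I_n}} :=
  \bigcup_(i | D i) [set e : {set 'I_n} | e \subset h i & #|e| == 2].

Lemma card_clique_edges D :
  (#|clique_edges D| <= \sum_(i | D i) 'C(rmult A lam i, 2))%N.
Proof.
rewrite /clique_edges.
elim/big_rec2: _ => [|i m E _ IH]; first by rewrite cards0.
rewrite -card_h -cards_draws; apply: leq_trans (leq_add (leqnn _) IH).
by rewrite -cardsUI leq_addr.
Qed.

Lemma edge_inj (v w1 w2 : 'I_n) : w1 != v -> w2 != v ->
  [set v; w1] = [set v; w2] -> w1 = w2.
Proof.
move=> /negPf v1 /negPf v2 /setP/(_ w1); rewrite !inE eqxx orbT v1 /=.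
by move/esym/eqP.
Qed.

Lemma aux_edge (D : pred 'I_(pr + q)) v w : aux v w ->
  (forall i, v \in h i -> w \in h i -> D i) -> [set v; w] \in clique_edges D.
Proof.
case/andP => vw /existsP [i /andP [vi wi]] hD; apply/bigcupP; exists i; first exact: hD.
by rewrite inE cards2 vw finset.subUset !finset.sub1set vi wi.
Qed.

Lemma card_star_edges v (W : {set 'I_n}) (E : {set {set 'I_n}}) :
  (forall w, w \in W -> aux v w) -> (forall w, w \in W -> [set v; w] \in E) ->
  (#|W| <= #|E|)%N.
Proof.
move=> WA WE; rewrite -(card_in_imset (f := fun w => [set v; w])).
  by apply: subset_leq_card; apply/fintype.subsetP => _ /imsetP [w wW ->]; exact: WE.
move=> w1 w2 /WA /andP [v1 _] /WA /andP [v2 _]; apply: edge_inj; by rewrite eq_sym.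
Qed.

Lemma card_nbr_colors_le_degree (c : coloring) v : (forall w, (#|c w| <= 1)%N) ->
  (#|nbr_colors aux c v| <= #|colored_nbrs c v|)%N.
Proof. by move=> c1; apply: card_nbr_colors_le => w _. Qed.

Lemma small_degree_single (c : coloring) :
  (forall v, v \in aux_vertices h -> (#|[set w | aux v w]| < l)%N) ->
  coloring_output A lam h c -> ~ multicolored c.
Proof.
move=> deg; apply: (@single_coloring_ind (fun=> True)) => // {}c v _ c1 [/andP [va _] _] nl.
have := deg v va; rewrite -[X in (_ < X)%N -> _]nl ltnNge => /negP; apply.
apply: leq_trans (card_nbr_colors_le_degree v c1) _; apply: subset_leq_card.
by apply/fintype.subsetP => w; rewrite !inE => /andP [].
Qed.

(** The degree of a vertex is less than the number of vertices, and at most the number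
    of edges. *)
Lemma many_colors_single (c : coloring) :
  (minn (\sum_(i < pr + q) rmult A lam i)
        (1 + \sum_(i < pr + q) 'C(rmult A lam i, 2)) <= l)%N ->
  coloring_output A lam h c -> ~ multicolored c.
Proof.
move=> hl; apply: small_degree_single => v va; apply: leq_trans hl; rewrite leq_min.
apply/andP; split.
  apply: (@leq_trans #|aux_vertices h|).
    apply: proper_card; apply/properP; split; last first.
      by exists v => //; rewrite inE /aux_graph eqxx.
    apply/fintype.subsetP => w; rewrite inE => /andP [_ /existsP [i /andP [_ wi]]].
    by apply/bigcupP; exists i.
  under eq_bigr do rewrite -card_h; rewrite /aux_vertices.
  elim/big_rec2: _ => [|i m E _ IH]; first by rewrite cards0.
  by apply: leq_trans (leq_add (leqnn _) IH); rewrite -cardsUI leq_addr.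
rewrite add1n ltnS; apply: leq_trans (card_clique_edges xpredT).
by apply: (@card_star_edges v) => w; rewrite inE // => vw; apply: aux_edge.
Qed.

Section DominantClique.
Variable istar : 'I_(pr + q).
Hypothesis card_l : (#|h istar| <= l)%N.
Hypothesis few_edges :
  (\sum_(i < pr + q | i != istar) 'C(rmult A lam i, 2) < #|h istar|)%N.

Let K := h istar.
(** The edges of all the cliques but K; every edge with an end point outside K is one. *)
Let outer_edges := clique_edges (fun i => i != istar).

Definition colored (c : coloring) : {set 'I_n} := [set v | c v != finset.set0].

Definition colored_outer_edges (c : coloring) : {set {set 'I_n}} :=
  [set e in outer_edges | e \subset colored c].

(** The saturation of an uncolored v in K is at most the number of colored vertices of K
    as long as its colored neighbors outside K bring no new color.  When they do, the
    edges between colored vertices coming from the other cliques pay for the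
    saturation, up to one. *)
Definition saturation_inv (c : coloring) : Prop :=
  forall v, v \in K -> uncolored h c v ->
    (#|nbr_colors aux c v| <= #|colored c :&: K|)%N \/
    (#|nbr_colors aux c v| <= #|colored_outer_edges c|.+1)%N.

Lemma card_outer_edges : (#|outer_edges| < #|K|)%N.
Proof. exact: leq_ltn_trans (card_clique_edges _) few_edges. Qed.

Lemma outer_edge v w : aux v w -> (v \notin K) || (w \notin K) ->
  [set v; w] \in outer_edges.
Proof.
move=> vw out; apply: aux_edge vw _ => i vi wi; apply: contraL out => /eqP ei.
by rewrite negb_or !negbK /K -ei vi wi.
Qed.

(** Colored neighbors inside K account for at most as many colors as there are colored
    vertices in K. *)
Lemma outer_nbr (c : coloring) v : (forall w, (#|c w| <= 1)%N) ->
  (#|colored c :&: K| < #|nbr_colors aux c v|)%N ->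
  exists w, [/\ aux v w, c w != finset.set0 & w \notin K].
Proof.
move=> c1 lt; have : (#|colored c :&: K| < #|colored_nbrs c v|)%N.
  exact: leq_trans lt (card_nbr_colors_le_degree v c1).
rewrite ltnNge => /negP le; apply/not_existsP => H; apply: le.
apply: subset_leq_card; apply/fintype.subsetP => w; rewrite !inE => /andP [vw cw].
by rewrite cw; apply: contraT => wK; case: (H w).
Qed.

(** A vertex outside K has too few edges.  For v in K seeing l >= |K| colors, at most
    |K| - 1 of them come from K, so the second alternative of the invariant gives
    |K| - 1 outer edges between colored vertices; an outer edge from v itself is one
    more, and there are fewer than |K| outer edges. *)
Lemma dominant_clique_no_multi (c : coloring) v : saturation_inv c ->
  (forall w, (#|c w| <= 1)%N) -> selectable h aux c v -> #|nbr_colors aux c v| <> l.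
Proof.
move=> inv c1 [unc _] nl.
have Kl : (#|K| <= #|nbr_colors aux c v|)%N by rewrite nl.
have [va /eqP cv0] := andP unc.
have [vK|vK] := boolP (v \in K); last first.
  have : (#|colored_nbrs c v| <= #|outer_edges|)%N.
    apply: (@card_star_edges v) => w; rewrite inE => /andP [vw _] //.
    by rewrite outer_edge ?vK.
  move/(leq_trans (card_nbr_colors_le_degree v c1))/(leq_trans Kl).
  by rewrite leqNgt card_outer_edges.
have ltK : (#|colored c :&: K| < #|nbr_colors aux c v|)%N.
  apply: leq_trans Kl; apply: proper_card; apply/properP; split.
    exact: finset.subsetIr.
  by exists v => //; rewrite !inE cv0 eqxx.
have [w [vw cw wK]] := outer_nbr c1 ltK.
have : (#|colored_outer_edges c| < #|outer_edges|)%N.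
  apply: proper_card; apply/properP; split.
    by apply/fintype.subsetP => e; rewrite inE => /andP [].
  exists [set v; w]; first by rewrite outer_edge // wK orbT.
  by rewrite inE finset.subUset !finset.sub1set !inE cv0 eqxx andbF.
case: (inv v vK unc) => [|le]; first by rewrite leqNgt ltK.
move=> lt; have := leq_trans Kl (leq_trans le lt).
by rewrite leqNgt card_outer_edges.
Qed.

Lemma colored_assign (c : coloring) u x :
  colored (assign c u [set x]) = u |: colored c.
Proof.
apply/setP => w; rewrite !inE assignE; case: (w =P u) => // _.
by apply/set0Pn; exists x; rewrite inE.
Qed.

Lemma nbr_colors_assign (c : coloring) u x v : c u = finset.set0 ->
  (#|nbr_colors aux (assign c u [set x]) v| <= aux v u + #|nbr_colors aux c v|)%N.
Proof.
move=> cu0; case vu: (aux v u).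
  apply: (@leq_trans #|x |: nbr_colors aux c v|); last first.
    by rewrite cardsU1 leq_add2r leq_b1.
  apply: subset_leq_card; apply/fintype.subsetP => y /bigcupP [w vw].
  rewrite assignE; case: eqP => [_|_ yw]; first by rewrite !inE => ->.
  by apply/setU1P; right; apply/bigcupP; exists w.
apply: subset_leq_card; apply/fintype.subsetP => y /bigcupP [w vw].
rewrite assignE; case: eqP => [e|_ yw]; first by rewrite -e vw in vu.
by apply/bigcupP; exists w.
Qed.

(** Coloring u raises the saturation of v by at most one.  If u is in K, either the
    saturation of v was accounted for by K, which gains a colored vertex, or u, being
    at least as saturated as v, has a colored neighbor outside K and brings a new
    outer edge.  If u is a neighbor of v outside K, all the edges from u to its
    colored neighbors become colored outer edges, and they are at least as many as the
    saturation of u, hence of v. *)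
Lemma saturation_inv_step (c : coloring) u x : saturation_inv c ->
  (forall w, (#|c w| <= 1)%N) -> selectable h aux c u ->
  saturation_inv (assign c u [set x]).
Proof.
move=> inv c1 [uncu umax] v vK uncv'.
have [ua /eqP cu0] := andP uncu.
have uncv : uncolored h c v.
  move: uncv'; rewrite /uncolored assignE; case: (v =P u) => // _ /andP [_ /eqP/setP/(_ x)].
  by rewrite !inE eqxx.
have sat' := nbr_colors_assign x v cu0.
have vu1 : (aux v u <= 1)%N := leq_b1 _.
have satu := umax v uncv.
have subE : colored_outer_edges c \subset colored_outer_edges (assign c u [set x]).
  apply/fintype.subsetP => e; rewrite !inE colored_assign => /andP [-> ec] /=.
  exact: fintype.subset_trans ec (finset.subsetUr _ _).
have leE := subset_leq_card subE.
have u_edge w : aux u w -> c w != finset.set0 -> (u \notin K) || (w \notin K) ->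
    [set u; w] \in colored_outer_edges (assign c u [set x]).
  move=> uw cw out; rewrite inE outer_edge //= colored_assign.
  by rewrite finset.subUset !finset.sub1set !inE eqxx cw orbT.
have [uK|uK] := boolP (u \in K).
  have -> : #|colored (assign c u [set x]) :&: K| = #|colored c :&: K|.+1.
    rewrite colored_assign finset.setIUl (finset.setIidPl _) ?finset.sub1set // cardsU1.
    by rewrite !inE cu0 eqxx.
  have [le|lt] := leqP #|nbr_colors aux c v| #|colored c :&: K|; first by
    left; apply: leq_trans sat' _; rewrite -add1n; exact: leq_add vu1 le.
  have [w [uw cw wK]] := outer_nbr c1 (leq_trans lt satu).
  have ltE : (#|colored_outer_edges c| < #|colored_outer_edges (assign c u [set x])|)%N.
    apply: proper_card; apply/properP; split => //.
    exists [set u; w]; first by rewrite u_edge // wK orbT.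
    by rewrite inE finset.subUset !finset.sub1set !inE cu0 eqxx andbF.
  case: (inv v vK uncv) => [|H]; first by rewrite leqNgt lt.
  right; apply: leq_trans sat' _; rewrite -add1n.
  exact: leq_add vu1 (leq_trans H ltE).
have jE : (#|colored c :&: K| <= #|colored (assign c u [set x]) :&: K|)%N.
  by rewrite subset_leq_card // colored_assign finset.setSI // finset.subsetUr.
have [vu|vu] := boolP (aux v u); last first.
  rewrite (negPf vu) add0n in sat'.
  case: (inv v vK uncv) => H; [left|right]; apply: leq_trans sat' (leq_trans H _) => //.
right; rewrite vu add1n in sat'; apply: leq_trans sat' _; rewrite ltnS.
apply: leq_trans satu (leq_trans (card_nbr_colors_le_degree u c1) _).
apply: (@card_star_edges u) => w; rewrite inE => /andP [uw cw] //.
by apply: u_edge => //; rewrite uK.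
Qed.

Lemma dominant_clique_single (c : coloring) :
  coloring_output A lam h c -> ~ multicolored c.
Proof.
apply: (@single_coloring_ind saturation_inv).
- move=> v vK _; left; rewrite [X in (X <= _)%N](_ : _ = 0%N) //.
  apply/eqP; rewrite cards_eq0 -finset.subset0; apply/fintype.subsetP => y /bigcupP [w _].
  by rewrite ffunE.
- exact: dominant_clique_no_multi.
- exact: saturation_inv_step.
Qed.
End DominantClique.
End SingleColoring.

(** * Approximation guarantees *)

Section TwoStageGuarantees.
Variables (R : realType) (n : nat) (A : 'M[R]_n).
Variables (pr q : nat) (lam : 'I_(pr + q + q) -> R[i]) (l : nat).
Hypothesis hinst : instance A lam l.

Notation coloring := {ffun 'I_n -> {set 'I_l}}.

Let hlam : spectrum_ordering A lam. Proof. by case: hinst. Qed.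
Let kmax_l : (kmax A lam <= l)%N. Proof. by case: hinst => _ /andP []. Qed.

Lemma Hset_card (X : forall i, 'M[R[i]]_(n, mult A lam i)) (h : 'I_(pr + q) -> {set 'I_n}) :
  (forall i, h i \in Hset X (lshift q i)) -> forall i, #|h i| = rmult A lam i.
Proof. by move=> hh i; have := hh i; rewrite inE => /andP [/eqP]. Qed.

(** Hence the cliques h i are nonempty, and there is at least one color. *)
Lemma mult_gt0 i : (0 < mult A lam i)%N.
Proof.
have [_ spec _ _] := hlam.
have /eigenvalueP [v va v0] : eigenvalue (cplx_mx A) (lam i) by apply/spec; exists i.
rewrite mult_kermx lt0n mxrank_eq0; apply: contra v0 => /eqP k0.
rewrite -submx0 -k0 sub_kermx mulmxBr mul_mx_scalar va subrr //.
Qed.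

Lemma two_stage_exists : exists c : coloring, two_stage A lam c.
Proof.
have [X hX] := left_null_basis_exists A lam.
have [S gS] := greedy_output_exists hX.
have [h hh] := greedy_output_bases gS.
have [||c hc] := @coloring_output_exists _ _ A _ _ lam l h.
- by apply: (@Hset_card X) => i; have [] := hh i.
- exact: kmax_l.
by exists c, X, S, h.
Qed.

Lemma two_stage_feasible (c : coloring) : two_stage A lam c -> feasible A (output_config c).
Proof.
case=> X [S [h [hX gS hh hc]]].
have hH i : h i \in Hset X (lshift q i) by have [] := hh i.
apply: (matching_feasible hX hlam hH) => i.
have card_h := Hset_card hH.
have /card_gt0P [a ai] : (0 < #|h i|)%N by rewrite card_h mult_gt0.
have [m minj mc] := coloring_output_matching card_h hc ai.
by exists m => // b bi; rewrite mxE mc.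
Qed.

(** The nonzero rows of a feasible configuration have maximal rank sum, hence compete
    with the greedy set, which contains all the vertices of the graph. *)
Lemma two_stage_bound (c : coloring) (Mopt : 'M[bool]_(n, l)) :
  two_stage A lam c -> optimal A Mopt ->
  exists h : 'I_(pr + q) -> {set 'I_n},
    [/\ forall i, #|h i| = rmult A lam i, coloring_output A lam h c &
    #|aux_vertices h|%:R <= (ln (Nmult A lam)%:R + 1) * (nnz Mopt)%:R :> R].
Proof.
case=> X [S [h [hX [rS gS] hh hc]]] [feas _]; exists h; split => //.
  by apply: (@Hset_card X) => i; have [] := hh i.
apply: (@le_trans _ _ #|S|%:R).
  rewrite ler_nat subset_leq_card //; apply/bigcupsP => i _; by have [] := hh i.
apply: le_trans (greedy_size (sum_mult_le hlam) (feasible_rank_sum hX feas) rS) _.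
by rewrite ler_wpM2l ?addr_ge0 ?ln_nat_ge0 // ler_nat card_row_support.
Qed.

Lemma achieves_approx_of_bound (alpha : R) :
  (forall (c : coloring) (Mopt : 'M[bool]_(n, l)), two_stage A lam c -> optimal A Mopt ->
     (nnz (output_config c))%:R <= alpha * (nnz Mopt)%:R) ->
  achieves_approx A lam l alpha.
Proof.
move=> bound; split; first exact: two_stage_exists.
by move=> c hc; split; [exact: two_stage_feasible|move=> Mopt; exact: bound].
Qed.

Lemma ln_Nmult_le : ln (Nmult A lam)%:R <= ln (n%:R : R).
Proof.
have Nn := Nmult_le hlam; case: (posnP (Nmult A lam)) => [->|N0].
  by rewrite [leLHS]ln0 // ln_nat_ge0.
by rewrite ler_ln ?posrE ?ltr0n ?ler_nat // (leq_trans N0).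
Qed.

Lemma achieves_approx_kmax : achieves_approx A lam l ((kmax A lam)%:R * (ln n%:R + 1)).
Proof.
apply: achieves_approx_of_bound => c Mopt hc hopt.
have [h [card_h ho hb]] := two_stage_bound hc hopt.
have := nnz_le_kmax card_h ho; rewrite -(ler_nat R) natrM => /le_trans; apply.
rewrite -mulrA ler_wpM2l // (le_trans hb) // ler_wpM2r // lerD2r ln_Nmult_le //.
Qed.

Lemma achieves_approx_single :
  (forall (c : coloring) (h : 'I_(pr + q) -> {set 'I_n}), (forall i, #|h i| = rmult A lam i) ->
     coloring_output A lam h c -> ~ multicolored c) ->
  achieves_approx A lam l (ln n%:R + 1).
Proof.
move=> single; apply: achieves_approx_of_bound => c Mopt hc hopt.
have [h [card_h ho hb]] := two_stage_bound hc hopt.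
have := nnz_le_single card_h ho (single c h card_h ho); rewrite -(ler_nat R) => /le_trans.
by apply; rewrite (le_trans hb) // ler_wpM2r // lerD2r ln_Nmult_le.
Qed.

Lemma bound_single (c : coloring) (Mopt : 'M[bool]_(n, l)) :
  two_stage A lam c -> optimal A Mopt -> ~ multicolored c ->
  (nnz (output_config c))%:R <= (ln (Nmult A lam)%:R + 1) * (nnz Mopt)%:R :> R.
Proof.
move=> hc hopt nm; have [h [card_h ho hb]] := two_stage_bound hc hopt.
by apply: le_trans hb; rewrite ler_nat (nnz_le_single card_h ho).
Qed.

Lemma bound_multi (c : coloring) (Mopt : 'M[bool]_(n, l)) :
  two_stage A lam c -> optimal A Mopt -> multicolored c ->
  (nnz (output_config c))%:R <=
    (kmax A lam)%:R * (ln (Nmult A lam)%:R + 1) * (nnz Mopt)%:R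
    - ((kmax A lam)%:R - 1) * l%:R :> R.
Proof.
move=> hc hopt m; have [h [card_h ho hb]] := two_stage_bound hc hopt.
have [le k0] := nnz_le_multi card_h ho m.
rewrite lerBrDr -mulrA; move: le; rewrite -(ler_nat R) natrD !natrM -subn1 natrB //.
by move/le_trans; apply; rewrite ler_wpM2l.
Qed.
End TwoStageGuarantees.

Lemma O_log_ln_add1 (R : realType) : O_log (fun n => ln (n%:R : R) + 1).
Proof.
apply/eqO_exP; exists 2 => //.
near=> n; have n3 : expR 1 <= n%:R :> R by near: n; exact: nbhs_infty_ger.
have ln1 : 1 <= ln (n%:R : R).
  by rewrite -[leLHS](@expRK R) ler_ln ?posrE ?expR_gt0 // (lt_le_trans _ n3) ?expR_gt0.
rewrite !ger0_norm; lra.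
Unshelve. all: by end_near. Qed.

Theorem theorem7 (R : realType) :
  [/\ (* O(kmax log n)-approximation *)
      exists2 alpha : nat -> R, O_log alpha &
        forall (n : nat) (A : 'M[R]_n) (pr q : nat)
               (lam : 'I_(pr + q + q) -> R[i]) (l : nat),
          instance A lam l ->
          achieves_approx A lam l ((kmax A lam)%:R * alpha n),
      (* bounds (I) and (II) *)
      forall (n : nat) (A : 'M[R]_n) (pr q : nat)
             (lam : 'I_(pr + q + q) -> R[i]) (l : nat),
        instance A lam l ->
        (Nmult A lam <= n)%N /\
        forall (c : {ffun 'I_n -> {set 'I_l}}) (Mopt : 'M[bool]_(n, l)),
          two_stage A lam c -> optimal A Mopt ->
          let Malg := output_config c in
          let boundI : Prop :=
            (nnz Malg)%:R <=
              (kmax A lam)%:R * (ln (Nmult A lam)%:R + 1) * (nnz Mopt)%:R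
              - ((kmax A lam)%:R - 1) * l%:R :> R in
          let boundII : Prop :=
            (nnz Malg)%:R <= (ln (Nmult A lam)%:R + 1) * (nnz Mopt)%:R :> R in
          [/\ boundI \/ boundII,
              ~ multicolored c -> boundII
            & multicolored c -> boundI],
      (* (i) *)
      exists2 alpha : nat -> R, O_log alpha &
        forall (n : nat) (A : 'M[R]_n) (pr q : nat)
               (lam : 'I_(pr + q + q) -> R[i]) (l : nat),
          instance A lam l ->
          (forall i, mult A lam i = 1%N) ->
          achieves_approx A lam l (alpha n),
      (* (ii) *)
      exists2 alpha : nat -> R, O_log alpha &
        forall (n : nat) (A : 'M[R]_n) (pr q : nat)
               (lam : 'I_(pr + q + q) -> R[i]) (l : nat) (istar : 'I_(pr + q)),
          instance A lam l ->
          rmult A lam istar = kmax A lam ->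
          (forall i, rmult A lam i = kmax A lam -> i = istar) ->
          (\sum_(i < pr + q | i != istar) 'C(rmult A lam i, 2) < kmax A lam)%N ->
          achieves_approx A lam l (alpha n)
    & (* (iii) *)
      exists2 alpha : nat -> R, O_log alpha &
        forall (n : nat) (A : 'M[R]_n) (pr q : nat)
               (lam : 'I_(pr + q + q) -> R[i]) (l : nat),
          instance A lam l ->
          (minn (\sum_(i < pr + q) rmult A lam i)
                (1 + \sum_(i < pr + q) 'C(rmult A lam i, 2)) <= l)%N ->
          achieves_approx A lam l (alpha n)].
Proof.
split.
- exists (fun n => ln n%:R + 1); first exact: O_log_ln_add1.
  by move=> n A pr q lam l hinst; exact: achieves_approx_kmax.
- move=> n A pr q lam l hinst; split; first by case: hinst => hlam _; exact: Nmult_le.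
  move=> c Mopt hc hopt Malg boundI boundII.
  have H1 : multicolored c -> boundI by exact: bound_multi.
  have H2 : ~ multicolored c -> boundII by exact: bound_single.
  by split => //; have [/H1|/H2] := pselect (multicolored c); [left|right].
- exists (fun n => ln n%:R + 1); first exact: O_log_ln_add1.
  move=> n A pr q lam l hinst mult1; apply: achieves_approx_of_bound => // c Mopt hc hopt.
  have [_ /(_ c hc) [_ /(_ Mopt hopt) H]] := achieves_approx_kmax hinst.
  apply: le_trans H _; rewrite ler_wpM2r // ler_piMl ?addr_ge0 ?ln_nat_ge0 //.
  by rewrite lern1; apply/bigmax_leqP => i _; rewrite mult1.
- exists (fun n => ln n%:R + 1); first exact: O_log_ln_add1.
  move=> n A pr q lam l istar hinst hk _ few; apply: achieves_approx_single => // c h card_h.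
  apply: (@dominant_clique_single _ _ A _ _ lam l h card_h istar).
  + by rewrite card_h hk; case: hinst => _ /andP [].
  + by rewrite card_h hk.
- exists (fun n => ln n%:R + 1); first exact: O_log_ln_add1.
  move=> n A pr q lam l hinst hl; apply: achieves_approx_single => // c h card_h.
  exact: many_colors_single.
Qed.
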